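(* For every $i=1,\dots,N$, $$\Bigl(\kappa\,q_i\frac{\partial}{\partial q_i}-X_i(z;h;q)\Bigr)\,\Omega_\lambda(q)\,\Phi_\lambda(t;z;h;q)\,W_\lambda(t;z)=\Omega_\lambda(q)\,\Phi_\lambda(t;z;h;q)\sum_{I\in\mathcal I_\lambda}D_{I,i}(t;z;h;q)\,v_I .$$
   Context: Fix positive integers $N,n$ and $h,\kappa\in\mathbb C^\times$. For $\lambda=(\lambda_1,\dots,\lambda_N)\in\mathbb Z_{\ge0}^N$ with $\lambda_1+\dots+\lambda_N=n$ put $\lambda^{(i)}=\lambda_1+\dots+\lambda_i$, $\lambda^{(0)}=0$; $\mathcal I_\lambda$ is the set of ordered partitions $I=(I_1,\dots,I_N)$ of $\{1,\dots,n\}$ into disjoint subsets with $|I_j|=\lambda_j$. Variables: $t=(t^{(j)}_a)$, $1\le j\le N-1$, $1\le a\le\lambda^{(j)}$; $t^{(N)}_a=z_a$; $q=(q_1,\dots,q_N)$. $\mathrm{Sym}_{x_1,\dots,x_k}f=\sum_{\sigma\in S_k}f(x_{\sigma(1)},\dots,x_{\sigma(k)})$; $\mathrm{Sym}_t=\mathrm{Sym}_{t^{(1)}_1,\dots,t^{(1)}_{\lambda^{(1)}}}\cdots\mathrm{Sym}_{t^{(N-1)}_1,\dots,t^{(N-1)}_{\lambda^{(N-1)}}}$. Empty products equal 1, empty sums 0. Tensor space. $v_1,\dots,v_N$ is the standard basis of $\mathbb C^N$; $v_I=v_{i_1}\otimes\dots\otimes v_{i_n}$ with $i_j=m$ if $j\in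 I_m$. $e_{i,j}v_k=\delta_{jk}v_i$, $e^{(a)}_{i,j}$ acts on the $a$-th tensor factor of $(\mathbb C^N)^{\otimes n}$, $\tilde e_{i,j}=\sum_a e^{(a)}_{i,j}$, and $$X_i(z;h;q)=\sum_{a=1}^n z_a e^{(a)}_{i,i}-h\Bigl(\frac{\tilde e_{i,i}(1-\tilde e_{i,i})}2+\sum_{1\le a<b\le n}\sum_{k=1}^N e^{(a)}_{i,k}e^{(b)}_{k,i}+\sum_{j\ne i}\frac{q_j}{q_i-q_j}(\tilde e_{i,j}\tilde e_{j,i}-\tilde e_{i,i})\Bigr).$$ Weight functions. For $I\in\mathcal I_\lambda$ write $I_1\cup\dots\cup I_j=\{i^{(j)}_1<\dots<i^{(j)}_{\lambda^{(j)}}\}$ and $$U_I(t;z)=\prod_{j=1}^{N-1}\prod_{a=1}^{\lambda^{(j)}}\Bigl(\prod_{c:\,i^{(j+1)}_c<i^{(j)}_a}(t^{(j)}_a-t^{(j+1)}_c)\prod_{d:\,i^{(j+1)}_d>i^{(j)}_a}(t^{(j)}_a-t^{(j+1)}_d-h)\prod_{b=a+1}^{\lambda^{(j)}}\frac{t^{(j)}_b-t^{(j)}_a-h}{t^{(j)}_b-t^{(j)}_a}\Bigr)$$ ($c,d\in\{1,\dots,\lambda^{(j+1)}\}$), $W_I=\mathrm{Sym}_t\,U_I$, $W_\lambda(t;z)=\sum_{I\in\mathcal I_\lambda}W_I(t;z)\,v_I$. Master function. With $\phi(x)=\Gamma(x/\kappa)\Gamma((h-x)/\kappa)$, $$\Phi_\lambda(t;z;h;q)=(e^{\pi\sqrt{-1}(n-\lambda_N)}q_N)^{\sum_{a}z_a/\kappa}\prod_{i=1}^{N-1}\Bigl(e^{\pi\sqrt{-1}(\lambda_{i+1}-\lambda_i)}\frac{q_i}{q_{i+1}}\Bigr)^{\sum_j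 t^{(i)}_j/\kappa}\prod_{i=1}^{N-1}\prod_{a=1}^{\lambda^{(i)}}\Bigl(\prod_{b\ne a}\frac1{(t^{(i)}_a-t^{(i)}_b-h)\phi(t^{(i)}_a-t^{(i)}_b)}\prod_{c=1}^{\lambda^{(i+1)}}\phi(t^{(i)}_a-t^{(i+1)}_c)\Bigr),$$ and $\Omega_\lambda(q)=\prod_{1\le i<j\le N}(1-q_j/q_i)^{h\lambda_i/\kappa}$ (the identity is for any local branches of the powers in $q$). Discrete differentials. For a partition $I$ with $I_i=\{\ell_{i,1}<\dots<\ell_{i,\lambda_i}\}$, $(I)^a_{i,j}$ is obtained from $I$ by moving $\ell_{i,a}$ from $I_i$ to $I_j$; it belongs to $\mathcal I_{\lambda_{i,j}}$, where $\lambda_{\alpha,\beta}$ is $\lambda$ with $\lambda_\alpha$ replaced by $\lambda_\alpha-1$ and $\lambda_\beta$ by $\lambda_\beta+1$. For $\alpha<\beta$ let $t_{\{\alpha,\beta\}}$ be $t$ with the variables $t^{(i)}_{\lambda^{(i)}}$, $\alpha\le i<\beta$, removed; for $J\in\mathcal I_{\lambda_{\alpha,\beta}}$, $U_J$ is a function of $t_{\{\alpha,\beta\}},z$. For a rational function $g$ of $t_{\{\alpha,\beta\}},z,q$ put $$d_{\{\alpha,\beta\}}g=\mathrm{Sym}_t\Bigl(\frac{g\,(q_\beta A_{\alpha,\beta}-q_\alpha B_{\alpha,\beta})}{q_\alpha-q_\beta}\Bigr),$$ $$A_{\alpha,\beta}=(t^{(\alpha-1)}_{\lambda^{(\alpha-1)}}-t^{(\alpha)}_{\lambda^{(\alpha)}})\prod_{i=\alpha}^{\beta-1}\prod_{a=1}^{\lambda^{(i-1)}-1}(t^{(i-1)}_a-t^{(i)}_{\lambda^{(i)}})\cdot(t^{(\beta-1)}_{\lambda^{(\beta-1)}}-t^{(\beta)}_{\lambda^{(\beta)}}-h)\prod_{i=\alpha}^{\beta-1}\prod_{a=1}^{\lambda^{(i+1)}-1}(t^{(i)}_{\lambda^{(i)}}-t^{(i+1)}_a-h)\prod_{i=\alpha}^{\beta-1}\prod_{a=1}^{\lambda^{(i)}-1}\frac{t^{(i)}_a-t^{(i)}_{\lambda^{(i)}}-h}{t^{(i)}_a-t^{(i)}_{\lambda^{(i)}}},$$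 $$B_{\alpha,\beta}=(t^{(\alpha-1)}_{\lambda^{(\alpha-1)}}-t^{(\alpha)}_{\lambda^{(\alpha)}}-h)\prod_{i=\alpha}^{\beta-1}\prod_{a=1}^{\lambda^{(i-1)}-1}(t^{(i-1)}_a-t^{(i)}_{\lambda^{(i)}}-h)\cdot(t^{(\beta-1)}_{\lambda^{(\beta-1)}}-t^{(\beta)}_{\lambda^{(\beta)}})\prod_{i=\alpha}^{\beta-1}\prod_{a=1}^{\lambda^{(i+1)}-1}(t^{(i)}_{\lambda^{(i)}}-t^{(i+1)}_a)\prod_{i=\alpha}^{\beta-1}\prod_{a=1}^{\lambda^{(i)}-1}\frac{t^{(i)}_{\lambda^{(i)}}-t^{(i)}_a-h}{t^{(i)}_{\lambda^{(i)}}-t^{(i)}_a},$$ where the factors containing $t^{(\alpha-1)}_{\lambda^{(\alpha-1)}}$ are replaced by 1 if $\lambda^{(\alpha-1)}=0$ (in particular if $\alpha=1$). Finally $$D_{I,i}=\sum_{j=1}^{i-1}\sum_{a=1}^{\lambda_j}d_{\{j,i\}}U_{(I)^a_{j,i}}-\sum_{j=i+1}^{N}\sum_{a=1}^{\lambda_i}d_{\{i,j\}}U_{(I)^a_{i,j}}.$$ *)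

(* Defs.v *)
From HB Require Import structures.
From mathcomp Require Import all_boot all_order all_algebra all_fingroup.
From mathcomp Require Import complex.
From mathcomp Require Import all_classical all_reals all_analysis.

Set Implicit Arguments.
Unset Strict Implicit.
Unset Printing Implicit Defensive.

Import Order.TTheory GRing.Theory Num.Theory numFieldNormedType.Exports.
Local Open Scope ring_scope.

(* Packing [R[i]] as a [numClosedFieldType] is what makes the topology, the
   norm and the derivatives of MathComp-Analysis available on it. *)
Definition cplx (R : realType) : numClosedFieldType := R[i].

(* Conventions.  The number of blocks is N = M.+1.  Blocks are numbered from 0:
   [i : 'I_M.+1] stands for the 1-based index i+1, also for q_i, v_i, lambda_i.
   Levels keep their numbers: level j carries the variables t^(j)_1, t^(j)_2,
   ..., which are [x j 0], [x j 1], ... for a family [x : nat -> nat -> cplx R];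
   level M.+1 carries z.  Only the entries [x j a] with [a < lamsum lam j] are
   used, so that removing the last variable of a level amounts to lowering
   [lamsum] there. *)

Section ComplexFunctions.
Variable R : realType.
Local Notation C := (cplx R).

Definition cexp (x : C) : C :=
  (expR (complex.Re x) * cos (complex.Im x)
   +i* (expR (complex.Re x) * sin (complex.Im x)))%C.

(* Gauss's product: lim_m  m! m^x / (x (x+1) ... (x+m)). *)
Definition cGamma (x : C) : C :=
  limn (fun m : nat =>
    (m`!)%:R * cexp (x * ((ln m%:R)%:C)%C) / \prod_(k < m.+1) (x + k%:R) : C).

Definition phi (h kap x : C) : C := cGamma (x / kap) * cGamma ((h - x) / kap).

(* [L] is a branch of log f near q; a local branch of f^a is then
   [cexp (a * L p)]. *)
Definition log_branch (M : nat) (f L : 'rV[C]_M.+1 -> C) (q : 'rV[C]_M.+1) :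
    Prop :=
  (\forall p \near q, differentiable L p /\ cexp (L p) = f p)%classic.

End ComplexFunctions.

Section Partitions.
Variables M n : nat.
Implicit Types (lam : 'I_M.+1 -> nat) (I : {ffun 'I_M.+1 -> {set 'I_n}}).

Definition lamsum lam (j : nat) : nat := (\sum_(k < M.+1 | (k < j)%N) lam k)%N.

Definition is_opart lam I : bool :=
  [&& [forall j, #|I j| == lam j],
      [forall j, forall k, (j != k) ==> [disjoint I j & I k]]
    & (\bigcup_j I j)%SET == [set: 'I_n]%SET].

(* The increasing list of the elements of I_1 u ... u I_j. *)
Definition initial_seq I (j : nat) : seq nat :=
  [seq nat_of_ord x | x <- enum (\bigcup_(m < M.+1 | (m < j)%N) I m)%SET].

Definition ipos I (j a : nat) : nat := nth 0%N (initial_seq I j) a.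

Definition lam_move lam (al be : 'I_M.+1) : 'I_M.+1 -> nat :=
  fun k => if k == al then (lam k).-1 else if k == be then (lam k).+1 else lam k.

Definition move I (l : 'I_n) (i j : 'I_M.+1) : {ffun 'I_M.+1 -> {set 'I_n}} :=
  [ffun m => if m == i then (I m :\ l)%SET
             else if m == j then (l |: I m)%SET else I m].

End Partitions.

Section TensorSpace.
Variables (R : realType) (M n : nat).
Local Notation C := (cplx R).

(* (C^N)^{\otimes n}, by coordinates in the basis
   v_(s 0) \otimes ... \otimes v_(s (n-1)), s : 'I_n -> 'I_N. *)
Definition tensor : lmodType C := {ffun {ffun 'I_n -> 'I_M.+1} -> C}.

Definition vbasis (s : {ffun 'I_n -> 'I_M.+1}) : tensor :=
  [ffun s' => (s' == s)%:R].

Definition vpart (I : {ffun 'I_M.+1 -> {set 'I_n}}) : tensor :=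
  vbasis [ffun a => odflt ord0 [pick m | a \in I m]].

Definition set_at (s : {ffun 'I_n -> 'I_M.+1}) (a : 'I_n) (i : 'I_M.+1) :
    {ffun 'I_n -> 'I_M.+1} :=
  [ffun b => if b == a then i else s b].

(* e^(a)_{i,j} *)
Definition e_at (a : 'I_n) (i j : 'I_M.+1) (w : tensor) : tensor :=
  \sum_s (w s * (s a == j)%:R) *: vbasis (set_at s a i).

Definition e_tot (i j : 'I_M.+1) (w : tensor) : tensor :=
  \sum_a e_at a i j w.

Definition Xop (h : C) (z : nat -> C) (q : 'rV[C]_M.+1) (i : 'I_M.+1)
    (w : tensor) : tensor :=
  \sum_(a < n) z a *: e_at a i i w
  - h *: (2^-1 *: e_tot i i (w - e_tot i i w)
          + \sum_(a < n) \sum_(b < n | (a < b)%N) \sum_(k < M.+1)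
              e_at a i k (e_at b k i w)
          + \sum_(j < M.+1 | j != i)
              (q 0 j / (q 0 i - q 0 j)) *:
                (e_tot i j (e_tot j i w) - e_tot i i w)).

Definition partial (i : 'I_M.+1) (F : 'rV[C]_M.+1 -> tensor)
    (q : 'rV[C]_M.+1) : tensor :=
  [ffun s => 'D_(delta_mx 0 i) (fun p => F p s) q].

End TensorSpace.

Section Symmetrization.
Variables (R : realType) (M : nat).
Local Notation C := (cplx R).
Implicit Types (x : nat -> nat -> C) (f : (nat -> nat -> C) -> C).

Definition vars (t : nat -> nat -> C) (z : nat -> C) : nat -> nat -> C :=
  fun j => if j == M.+1 then z else t j.

Definition permute (j k : nat) (s : 'S_k) x : nat -> nat -> C :=
  fun i a =>
    if i == j then
      if (insub a : option 'I_k) is Some o then x j (s o) else x j a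
    else x i a.

Definition Sym_level (j k : nat) f : (nat -> nat -> C) -> C :=
  fun x => \sum_(s : 'S_k) f (permute j s x).

(* Sym over level 1 of Sym over level 2 ... of Sym over level N-1 = M *)
Definition Sym (lam : 'I_M.+1 -> nat) f : (nat -> nat -> C) -> C :=
  foldr (fun j g => Sym_level j (lamsum lam j) g) f (iota 1 M).

End Symmetrization.

Section WeightFunctions.
Variables (R : realType) (M n : nat) (h : cplx R) (lam : 'I_M.+1 -> nat).
Local Notation C := (cplx R).
Implicit Types (I : {ffun 'I_M.+1 -> {set 'I_n}}) (x : nat -> nat -> C).

Definition Ufun I x : C :=
  \prod_(1 <= j < M.+1) \prod_(0 <= a < lamsum lam j)
    ((\prod_(0 <= c < lamsum lam j.+1 | (ipos I j.+1 c < ipos I j a)%N)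
        (x j a - x j.+1 c))
     * (\prod_(0 <= d < lamsum lam j.+1 | (ipos I j a < ipos I j.+1 d)%N)
        (x j a - x j.+1 d - h))
     * \prod_(a.+1 <= b < lamsum lam j)
        ((x j b - x j a - h) / (x j b - x j a))).

Definition Wfun I x : C := Sym lam (Ufun I) x.

Definition Wlam x : tensor R M n :=
  \sum_(I | is_opart lam I) Wfun I x *: vpart R I.

End WeightFunctions.

Section MasterFunction.
Variables (R : realType) (M n : nat) (h kap : cplx R) (lam : 'I_M.+1 -> nat).
Local Notation C := (cplx R).
Implicit Types (x : nat -> nat -> C) (p : 'rV[C]_M.+1).

Let imag (r : R) : C := (0 +i* r)%C.

(* e^{pi i (n - lambda_N)} q_N *)
Definition base_last p : C :=
  cexp (imag (pi * (n%:R - (lam ord_max)%:R))) * p 0 ord_max.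

(* e^{pi i (lambda_{i+1} - lambda_i)} q_i / q_{i+1}, with i counted from 0 *)
Definition base_mid (i : 'I_M) p : C :=
  cexp (imag (pi * ((lam (inord i.+1))%:R - (lam (inord i))%:R)))
  * (p 0 (inord i) / p 0 (inord i.+1)).

Definition base_Omega (i j : 'I_M.+1) p : C := 1 - p 0 j / p 0 i.

(* [l_last], [l_mid i], [l_Om i j] stand for branches of the logarithms of
   [base_last], [base_mid i], [base_Omega i j]. *)
Definition Phi (l_last : 'rV[C]_M.+1 -> C) (l_mid : 'I_M -> 'rV[C]_M.+1 -> C)
    x p : C :=
  cexp ((\sum_(a < n) x M.+1 a) / kap * l_last p)
  * (\prod_(i < M)
       cexp ((\sum_(0 <= a < lamsum lam i.+1) x i.+1 a) / kap * l_mid i p))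
  * \prod_(1 <= i < M.+1) \prod_(0 <= a < lamsum lam i)
      ((\prod_(0 <= b < lamsum lam i | b != a)
          (1 / ((x i a - x i b - h) * phi h kap (x i a - x i b))))
       * \prod_(0 <= c < lamsum lam i.+1) phi h kap (x i a - x i.+1 c)).

Definition Omega (l_Om : 'I_M.+1 -> 'I_M.+1 -> 'rV[C]_M.+1 -> C) p : C :=
  \prod_(i < M.+1) \prod_(j < M.+1 | (i < j)%N)
    cexp (h * (lam i)%:R / kap * l_Om i j p).

End MasterFunction.

Section DiscreteDifferentials.
Variables (R : realType) (M n : nat) (h : cplx R) (lam : 'I_M.+1 -> nat).
Local Notation C := (cplx R).
Variable q : 'rV[C]_M.+1.
Implicit Types (I : {ffun 'I_M.+1 -> {set 'I_n}}) (x : nat -> nat -> C).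

Local Notation L := (lamsum lam).

Let last x (i : nat) : C := x i (L i).-1.

(* In [Afun] and [Bfun], [al] and [be] are levels, counted from 1. *)
Definition Afun (al be : nat) x : C :=
  (if L al.-1 == 0%N then 1 else last x al.-1 - last x al)
  * (\prod_(al <= i < be) \prod_(0 <= a < (L i.-1).-1)
       (x i.-1 a - last x i))
  * (last x be.-1 - last x be - h)
  * (\prod_(al <= i < be) \prod_(0 <= a < (L i.+1).-1)
       (last x i - x i.+1 a - h))
  * \prod_(al <= i < be) \prod_(0 <= a < (L i).-1)
       ((x i a - last x i - h) / (x i a - last x i)).

Definition Bfun (al be : nat) x : C :=
  (if L al.-1 == 0%N then 1 else last x al.-1 - last x al - h)
  * (\prod_(al <= i < be) \prod_(0 <= a < (L i.-1).-1)
       (x i.-1 a - last x i - h))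
  * (last x be.-1 - last x be)
  * (\prod_(al <= i < be) \prod_(0 <= a < (L i.+1).-1)
       (last x i - x i.+1 a))
  * \prod_(al <= i < be) \prod_(0 <= a < (L i).-1)
       ((last x i - x i a - h) / (last x i - x i a)).

(* d_{al,be} g; [g] is meant not to depend on the last variables of the levels
   removed from t, as is the case for [Ufun h (lam_move lam al be) J]. *)
Definition ddiff (al be : 'I_M.+1) (g : (nat -> nat -> C) -> C) x : C :=
  Sym lam (fun y =>
    g y * (q 0 be * Afun al.+1 be.+1 y - q 0 al * Bfun al.+1 be.+1 y)
    / (q 0 al - q 0 be)) x.

(* The sums over a = 1 .. lambda_i of terms depending on l_{i,a} are sums over
   the elements of I_i. *)
Definition Dfun I (i : 'I_M.+1) x : C :=
  \sum_(j < M.+1 | (j < i)%N) \sum_(l in I j)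
     ddiff j i (Ufun h (lam_move lam j i) (move I l j i)) x
  - \sum_(j < M.+1 | (i < j)%N) \sum_(l in I i)
     ddiff i j (Ufun h (lam_move lam i j) (move I l i j)) x.

End DiscreteDifferentials.

(* Main.v *)
Require Import Defs.
From HB Require Import structures.
From mathcomp Require Import all_boot all_order all_algebra all_fingroup.
From mathcomp Require Import complex.
From mathcomp Require Import all_classical all_reals all_analysis.
From mathcomp Require Import ring lra zify.

Set Implicit Arguments.
Unset Strict Implicit.
Unset Printing Implicit Defensive.

Import Order.TTheory GRing.Theory Num.Theory numFieldNormedType.Exports.
Local Open Scope ring_scope.

(** Why the theorem holds.

    A partition is read as a row of [n] items. The element [l] of the block with
    1-based number [m] occupies the levels [m], ..., [N], and has one variable
    on each of them. The function [U_I] is then a product over pairs of items of a factor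
    ([inter]) which depends on the order of the two items. In this picture,
    multiplying [U_J] by [B_(al,be)], or by [A_(al,be)] up to a rotation of the
    variables, means adding one more item at the end or at the front of the row
    of [J]: a ghost, which occupies the levels [al], ..., [be - 1] just vacated
    by the element which was moved from block [al] to block [be] ([ddiff_ghost]).

    Now let the ghost travel through the row, one item at a time. Two neighbouring
    items which change places only affect the variables of the levels which
    they both occupy, and the difference vanishes after symmetrization, except
    when the item passed starts exactly on the level above the ghost. In this
    case the difference is [h] times the weight of the row in which the two are
    joined, that is, in which the item passed now belongs to block [al] ([crossing]).
    So the difference between the ghost at the end and at the front is [h] times the sum of
    [W_I] and of its transforms under transpositions of sites, which are the terms
    of the operator [X_i] with a coefficient [q_j / (q_i - q_j)]. A ghost next to its former
    element instead gives [W_I] times a difference of two variables of this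
    element, up to a shift by [h]; these differences telescope to the sums of the variables of the
    levels [i] and [i - 1] ([ghosts_at_home]). On the way from its home to an end, the ghost
    passes exactly the elements whose transposition with its own element occurs in the double
    sum of [X_i]. Together this is the identity of every coordinate
    ([coefficient_identity]).

    The vanishing of the difference rests on an induction over the common levels:
    averaging over the exchange of the two variables of the extreme level leaves
    an expression of the same form on one level less, and on a single level the
    expression is antisymmetric ([Sym_chain_top], [Sym_chain_bottom]).

    Of the master function only its logarithmic derivative in [q_i] matters.
    It is found from the derivatives of the functions whose logarithms are
    chosen ([logder_master]); the Gamma factors are constants. *)

(** * Symmetrization over the integration variables *)

Section SymmetrizationTheory.
Variables (R : realType) (M : nat) (lam : 'I_M.+1 -> nat).
Local Notation C := (cplx R).
Implicit Types (x y : nat -> nat -> C) (f g : (nat -> nat -> C) -> C).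
Local Notation L := (lamsum lam).

Lemma permuteE_in j k (s : 'S_k) x a (lt_ak : (a < k)%N) :
  permute j s x j a = x j (s (Ordinal lt_ak)).
Proof. by rewrite /permute eqxx insubT. Qed.

Lemma permuteE_out j k (s : 'S_k) x i a :
  i != j \/ (k <= a)%N -> permute j s x i a = x i a.
Proof.
rewrite /permute; case: eqP => [->|//] [//|le_ka].
by rewrite insubF // ltnNge le_ka.
Qed.

Lemma permuteM j k (s u : 'S_k) x :
  permute j s (permute j u x) = permute j (s * u)%g x.
Proof.
apply/funext => i; apply/funext => a.
have [->|ne_ij] := eqVneq i j; last by rewrite !permuteE_out //; left.
have [lt_ak|le_ka] := ltnP a k; last by rewrite !permuteE_out //; right.
rewrite !(permuteE_in _ _ _ lt_ak) (permuteE_in _ _ _ (ltn_ord _)) permM.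
by congr (x j (nat_of_ord (u _))); apply/val_inj.
Qed.

Lemma permuteC j j' k k' (s : 'S_k) (u : 'S_k') x : j != j' ->
  permute j s (permute j' u x) = permute j' u (permute j s x).
Proof.
move=> ne; apply/funext => i; apply/funext => a.
have [->|ne_ij] := eqVneq i j.
  rewrite [RHS]permuteE_out; last by left.
  have [lt_ak|le_ka] := ltnP a k; last first.
    by rewrite !permuteE_out //; solve [by left|by right|by left; rewrite eq_sym].
  by rewrite !(permuteE_in _ _ _ lt_ak) permuteE_out //; left.
rewrite [LHS]permuteE_out; last by left.
have [->|ne_ij'] := eqVneq i j'; last by rewrite !permuteE_out //; left.
have [lt_ak|le_ka] := ltnP a k'; last first.
  by rewrite !permuteE_out //; solve [by left|by right|by left; rewrite eq_sym].
by rewrite !(permuteE_in _ _ _ lt_ak) permuteE_out //; left; rewrite eq_sym.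
Qed.

Definition Sym_levels (l : seq nat) f :=
  foldr (fun j g => Sym_level j (L j) g) f l.

Lemma Sym_levelE f : Defs.Sym lam f = Sym_levels (iota 1 M) f.
Proof. by []. Qed.

Lemma Sym_levels_out l j k (s : 'S_k) f x : j \notin l ->
  Sym_levels l (fun y => f (permute j s y)) x = Sym_levels l f (permute j s x).
Proof.
elim: l x => [//|j' l IH] x /=; rewrite inE negb_or => /andP[ne nl].
rewrite /Sym_level; apply: eq_bigr => u _.
by rewrite IH // permuteC.
Qed.

Lemma Sym_levels_permute l j (s : 'S_(L j)) f x : uniq l -> j \in l ->
  Sym_levels l (fun y => f (permute j s y)) x = Sym_levels l f x.
Proof.
elim: l x => [//|j' l IH] x /= /andP[nl ul]; rewrite inE /Sym_level.
have [e|ne] := eqVneq j j' => /= jl; last by apply: eq_bigr => u _; rewrite IH.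
subst j'.
rewrite (reindex_inj (mulgI s^-1%g)) /=; apply: eq_bigr => u _.
by rewrite Sym_levels_out // permuteM mulKVg.
Qed.

Lemma Sym_permute j (s : 'S_(L j)) f x : (1 <= j <= M)%N ->
  Defs.Sym lam (fun y => f (permute j s y)) x = Defs.Sym lam f x.
Proof.
by move=> jM; rewrite !Sym_levelE Sym_levels_permute ?iota_uniq // mem_iota add1n ltnS.
Qed.

Definition Sym_stable (P : (nat -> nat -> C) -> Prop) :=
  forall j (s : 'S_(L j)) y, (1 <= j <= M)%N -> P y -> P (permute j s y).

Lemma Sym_ext_in (P : (nat -> nat -> C) -> Prop) f g x :
    Sym_stable P -> P x -> (forall y, P y -> f y = g y) ->
  Defs.Sym lam f x = Defs.Sym lam g x.
Proof.
move=> stP Px efg; rewrite !Sym_levelE.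
have : all (fun j => 1 <= j <= M)%N (iota 1 M).
  by apply/allP => j; rewrite mem_iota add1n ltnS.
elim: (iota 1 M) x Px => [|j l IH] x Px /=; first by rewrite efg.
move=> /andP[jM lM]; apply: eq_bigr => s _; apply: IH => //.
exact: stP.
Qed.

Lemma Sym_ext f g x : f =1 g -> Defs.Sym lam f x = Defs.Sym lam g x.
Proof. by move=> e; apply: (@Sym_ext_in (fun=> True)). Qed.

Lemma SymD f g x : Defs.Sym lam (fun y => f y + g y) x = Defs.Sym lam f x + Defs.Sym lam g x.
Proof.
rewrite !Sym_levelE; elim: (iota 1 M) x => [//|j l IH] x /=.
by rewrite /Sym_level -big_split; apply: eq_bigr => s _; apply: IH.
Qed.

Lemma SymZ c f x : Defs.Sym lam (fun y => c * f y) x = c * Defs.Sym lam f x.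
Proof.
rewrite !Sym_levelE; elim: (iota 1 M) x => [//|j l IH] x /=.
by rewrite /Sym_level mulr_sumr; apply: eq_bigr => s _; apply: IH.
Qed.

Lemma SymB f g x : Defs.Sym lam (fun y => f y - g y) x = Defs.Sym lam f x - Defs.Sym lam g x.
Proof.
rewrite (Sym_ext (g := fun y => f y + (-1) * g y)) => [|y]; last by rewrite mulN1r.
by rewrite SymD SymZ mulN1r.
Qed.

Lemma Sym0 x : Defs.Sym lam (fun=> 0) x = 0.
Proof.
rewrite -[RHS](mul0r (Defs.Sym lam (fun=> 0) x)) -SymZ.
by apply: Sym_ext => y; rewrite mul0r.
Qed.

Lemma Sym_sum (I : Type) (r : seq I) (P : pred I) (f : I -> (nat -> nat -> C) -> C) x :
  Defs.Sym lam (fun y => \sum_(i <- r | P i) f i y) x = \sum_(i <- r | P i) Defs.Sym lam (f i) x.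
Proof.
elim: r => [|i r IH].
  by rewrite big_nil -[RHS](Sym0 x); apply: Sym_ext => y; rewrite big_nil.
rewrite big_cons -IH; case: ifP => Pi; last by apply: Sym_ext => y; rewrite big_cons Pi.
by rewrite -SymD; apply: Sym_ext => y; rewrite big_cons Pi.
Qed.

Lemma Sym_pull phi f x :
    (forall j (s : 'S_(L j)) y, (1 <= j <= M)%N -> phi (permute j s y) = phi y) ->
  Defs.Sym lam (fun y => phi y * f y) x = phi x * Defs.Sym lam f x.
Proof.
move=> inv; rewrite -SymZ.
apply: (@Sym_ext_in (fun y => phi y = phi x)) => [j s y jM <-||y ->] //.
exact: inv.
Qed.

Definition swap j r x : nat -> nat -> C := fun i a =>
  if i == j then x j (if a == r then r.+1 else if a == r.+1 then r else a)
  else x i a.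

Lemma swap_permute j r x (lt_r : (r < L j)%N) (lt_r1 : (r.+1 < L j)%N) :
  swap j r x = permute j (tperm (Ordinal lt_r) (Ordinal lt_r1)) x.
Proof.
apply/funext => i; apply/funext => a; rewrite /swap.
have [->|ne] := eqVneq i j; last by rewrite permuteE_out //; left.
have [lt_a|le_a] := ltnP a (L j); last first.
  rewrite permuteE_out; last by right.
  by rewrite !gtn_eqF ?(leq_trans _ le_a).
rewrite (permuteE_in _ _ _ lt_a) permE /= -!val_eqE /=.
by case: ifP => // _; case: ifP.
Qed.

Lemma Sym_swap j r f x : (1 <= j <= M)%N -> (r.+1 < L j)%N ->
  Defs.Sym lam (fun y => f (swap j r y)) x = Defs.Sym lam f x.
Proof.
move=> jM lt_r1; rewrite -[RHS](Sym_permute (tperm (Ordinal (ltnW lt_r1)) (Ordinal lt_r1))) //.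
by apply: Sym_ext => y; rewrite -swap_permute.
Qed.

(** No denominator of the weight functions vanishes at such a point. *)
Definition distinct x := forall j a b, (1 <= j <= M)%N ->
  (a < L j)%N -> (b < L j)%N -> a <> b -> x j a <> x j b.

Lemma distinct_stable : Sym_stable distinct.
Proof.
move=> j s y jM dy i a b iM lta ltb ne.
have [e|ne_ij] := eqVneq i j; last by rewrite !permuteE_out; [apply: dy|left|left].
subst i; rewrite (permuteE_in _ _ _ lta) (permuteE_in _ _ _ ltb); apply: dy => // e; apply: ne.
by have /perm_inj := val_inj e; case.
Qed.

Lemma Sym_ext_distinct f g x : distinct x ->
  (forall y, distinct y -> f y = g y) -> Defs.Sym lam f x = Defs.Sym lam g x.
Proof. exact/Sym_ext_in/distinct_stable. Qed.

(** Averaging over one transposition does not change a symmetrization, so that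
    identities between symmetrizations may be checked after such an average. *)
Lemma Sym_swap_ext j r f g x : (1 <= j <= M)%N -> (r.+1 < L j)%N -> distinct x ->
    (forall y, distinct y -> f y + f (swap j r y) = g y + g (swap j r y)) ->
  Defs.Sym lam f x = Defs.Sym lam g x.
Proof.
move=> jM ltr dx e; have two_n0 : (2 : C) != 0 by rewrite pnatr_eq0.
apply: (mulfI two_n0).
have twice f' : 2 * Defs.Sym lam f' x = Defs.Sym lam (fun y => f' y + f' (swap j r y)) x.
  by rewrite (SymD f') Sym_swap // mulr_natl.
by rewrite !twice; apply: Sym_ext_distinct.
Qed.

End SymmetrizationTheory.

(** * Vanishing of symmetrized chains *)

Section ChainIdentities.
Variables (R : realType) (M : nat) (lam : 'I_M.+1 -> nat) (h : cplx R).
Local Notation C := (cplx R).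
Local Notation L := (lamsum lam).
Implicit Types (x y : nat -> nat -> C) (K : (nat -> nat -> C) -> C).
Variable off : nat -> nat.

Local Notation lower y j := (y j (off j)).
Local Notation upper y j := (y j (off j).+1).

Definition exchange j y := swap j (off j) y.

Lemma lower_exchange j y : lower (exchange j y) j = upper y j.
Proof. by rewrite /exchange /swap !eqxx. Qed.

Lemma upper_exchange j y : upper (exchange j y) j = lower y j.
Proof. by rewrite /exchange /swap !eqxx gtn_eqF. Qed.

Lemma exchange_level i j y : i != j -> exchange j y i = y i.
Proof. by move=> ne; apply/funext => a; rewrite /exchange /swap (negPf ne). Qed.

(** The factor which two neighbouring items owe to the levels [lo], ..., [e]
    occupied by both, apart from what happens at the two ends of this range: on
    each level [lower] is the variable of the left item and [upper] that of the
    right item. *)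
Definition chain lo e y :=
  \prod_(lo <= j < e.+1) ((upper y j - lower y j - h) / (upper y j - lower y j))
  * \prod_(lo <= j < e) ((lower y j - upper y j.+1 - h) * (upper y j - lower y j.+1)).

Definition exchange_inv lo e K :=
  forall j y, (lo <= j <= e)%N -> K (exchange j y) = K y.

Lemma chain_id lo y :
  chain lo lo y = (upper y lo - lower y lo - h) / (upper y lo - lower y lo).
Proof. by rewrite /chain big_nat1 big_geq // mulr1. Qed.

Lemma chain_recr lo e y : (lo <= e)%N ->
  chain lo e.+1 y = chain lo e y
    * ((lower y e - upper y e.+1 - h) * (upper y e - lower y e.+1))
    * ((upper y e.+1 - lower y e.+1 - h) / (upper y e.+1 - lower y e.+1)).
Proof.
move=> le; rewrite /chain big_nat_recr ?leqW //= [in X in _ * X = _]big_nat_recr //=.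
by rewrite mulrACA -[RHS]mulrA [X in _ = _ * X]mulrC.
Qed.

Lemma chain_recl lo e y : (lo <= e)%N ->
  chain lo e.+1 y = chain lo.+1 e.+1 y
    * ((lower y lo - upper y lo.+1 - h) * (upper y lo - lower y lo.+1))
    * ((upper y lo - lower y lo - h) / (upper y lo - lower y lo)).
Proof.
move=> le; rewrite /chain big_nat_recl ?leqW //= [in X in _ * X = _]big_nat_recl //=.
rewrite !(big_add1 _ _ _ _ xpredT) /= mulrACA mulrC -[RHS]mulrA.
by congr (_ * _); rewrite mulrC.
Qed.

Lemma chain_exchange lo e j y : (j < lo)%N || (e < j)%N ->
  chain lo e (exchange j y) = chain lo e y.
Proof.
move=> out; rewrite /chain; congr (_ * _); apply: eq_big_nat => i /andP[le_i i_lt].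
  by rewrite !exchange_level //; lia.
by rewrite !exchange_level //; lia.
Qed.

End ChainIdentities.

(** One step of the descent: [w] and [u] are the variables of one level, [p] and [r]
    those of the next one. Averaging over the exchange of [u] and [w] trades
    the linear factor [w - u + h] for [p - r + h], up to a factor which is
    symmetric in [u] and [w]. *)
Lemma exchange_average (F : numFieldType) (h k c p r u w : F) : u != w ->
  k * (c * ((r - w - h) * (p - u)) * ((w - u - h) / (w - u))) * (w - u + h)
  + k * (c * ((r - u - h) * (p - w)) * ((u - w - h) / (u - w))) * (u - w + h)
  = - k * ((w - u) ^+ 2 - h ^+ 2) * c * (p - r + h).
Proof.
move=> ne; have n1 : w - u != 0 by rewrite subr_eq0 eq_sym.
have n2 : u - w != 0 by rewrite subr_eq0.
by field; rewrite n1 n2.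
Qed.

Lemma exchange_average_up (F : numFieldType) (h k c p r u w : F) : u != w ->
  k * (c * ((u - p - h) * (w - r)) * ((w - u - h) / (w - u))) * (w - u + h)
  + k * (c * ((w - p - h) * (u - r)) * ((u - w - h) / (u - w))) * (u - w + h)
  = - k * ((w - u) ^+ 2 - h ^+ 2) * c * (p - r + h).
Proof.
move=> ne; have n1 : w - u != 0 by rewrite subr_eq0 eq_sym.
have n2 : u - w != 0 by rewrite subr_eq0.
by field; rewrite n1 n2.
Qed.

Lemma exchange_average0 (F : numFieldType) (h k u w : F) : u != w ->
  k * ((w - u - h) / (w - u)) * (w - u + h)
  + k * ((u - w - h) / (u - w)) * (u - w + h) = 0.
Proof.
move=> ne; have n1 : w - u != 0 by rewrite subr_eq0 eq_sym.
have n2 : u - w != 0 by rewrite subr_eq0.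
by field; rewrite n1 n2.
Qed.

Section ChainVanishing.
Variables (R : realType) (M : nat) (lam : 'I_M.+1 -> nat) (h : cplx R).
Local Notation C := (cplx R).
Local Notation L := (lamsum lam).
Implicit Types (x y : nat -> nat -> C) (K : (nat -> nat -> C) -> C).
Variable off : nat -> nat.

Local Notation lower y j := (y j (off j)).
Local Notation upper y j := (y j (off j).+1).

Local Notation in_range lo e :=
  (forall j, (lo <= j <= e)%N -> ((1 <= j <= M) && ((off j).+1 < L j))%N).

Lemma distinct_pair y j : distinct lam y ->
  ((1 <= j <= M) && ((off j).+1 < L j))%N -> lower y j != upper y j.
Proof.
move=> dy /andP[jM lt]; apply/eqP; apply: dy => //; exact: ltnW.
Qed.

(** Averaging over the exchange on level [e] moves the last factor to level
    [e - 1], and so on downwards; on level [lo] the function has become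
    antisymmetric under the exchange. *)
Lemma Sym_chain_top lo e K x : (lo <= e)%N -> in_range lo e -> distinct lam x ->
    exchange_inv off lo e K ->
  Defs.Sym lam (fun y => K y * chain h off lo e y * (upper y e - lower y e + h)) x = 0.
Proof.
move=> /subnKC <- rg dx; move: rg.
elim: (e - lo)%N K => [|m IH] K; rewrite ?addn0 ?addnS => rg invK.
  rewrite -(Sym0 lam x).
  have rge : (lo <= lo <= lo)%N by rewrite leqnn.
  have /andP[jM lt] := rg _ rge.
  apply: (Sym_swap_ext jM lt dx) => y dy.
  rewrite -/(exchange off lo y) !chain_id lower_exchange upper_exchange invK ?leqnn //.
  by rewrite exchange_average0 ?addr0 // distinct_pair // jM.
move: rg invK IH (leq_addr m lo); move: (lo + m)%N => {}e rg invK IH le.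
have rge : (lo <= e.+1 <= e.+1)%N by rewrite leqnn leqW.
have /andP[jM lt] := rg _ rge.
(* Half of the symmetric factor left by the average. *)
pose K' y := - 2^-1 * K y * ((upper y e.+1 - lower y e.+1) ^+ 2 - h ^+ 2).
rewrite -[RHS](IH K').
- apply: (Sym_swap_ext jM lt dx) => y dy.
  rewrite -/(exchange off e.+1 y) !chain_recr // /K'.
  rewrite !lower_exchange !upper_exchange !exchange_level ?ltn_eqF //.
  rewrite !chain_exchange ?ltnSn ?orbT // invK //.
  rewrite exchange_average ?distinct_pair ?jM //.
  have t0 : (2 : C) != 0 by rewrite pnatr_eq0.
  by field.
- by move=> j /andP[lj je]; apply: rg; rewrite lj leqW.
- move=> j y /andP[lj je]; rewrite /K' !exchange_level ?invK //; first by rewrite lj leqW.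
  by rewrite gtn_eqF // ltnS.
Qed.

Lemma Sym_chain_bottom lo e K x : (lo <= e)%N -> in_range lo e -> distinct lam x ->
    exchange_inv off lo e K ->
  Defs.Sym lam (fun y => K y * chain h off lo e y * (upper y lo - lower y lo + h)) x = 0.
Proof.
move=> le; have [m] := ubnP (e - lo).
elim: m lo le K => // m IH lo le K lt_m rg dx invK.
have rge : (lo <= lo <= e)%N by rewrite leqnn.
have /andP[jM lt] := rg _ rge.
case: (ltngtP lo e) le => // [lt_e|e_lo] _; last first.
  by move: rg invK; rewrite -e_lo => rg invK; apply: Sym_chain_top.
case: e => // e in IH lt_m lt_e rg invK rge *.
have le_e : (lo <= e)%N by rewrite -ltnS.
pose K' y := - 2^-1 * K y * ((upper y lo - lower y lo) ^+ 2 - h ^+ 2).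
rewrite -[RHS](IH lo.+1 _ K').
- apply: (Sym_swap_ext jM lt dx) => y dy.
  rewrite -/(exchange off lo y) !(chain_recl _ _ _ le_e) /K'.
  rewrite !lower_exchange !upper_exchange !exchange_level ?gtn_eqF //.
  rewrite !chain_exchange ?ltnSn // invK //.
  rewrite exchange_average_up ?distinct_pair ?jM //.
  have t0 : (2 : C) != 0 by rewrite pnatr_eq0.
  by field.
- by [].
- by lia.
- by move=> j /andP[lj je]; apply: rg; rewrite je ltnW.
- by [].
- move=> j y /andP[lj je]; rewrite /K' !exchange_level ?invK //; first by rewrite je ltnW.
  by rewrite ltn_eqF.
Qed.

Lemma exchange_inv_sum lo e j : exchange_inv off lo e (fun y => upper y j + lower y j).
Proof.
move=> i y _; have [->|ne] := eqVneq i j; last by rewrite !exchange_level // eq_sym.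
by rewrite lower_exchange upper_exchange addrC.
Qed.

Section Brackets.
Variables (lo e : nat) (K a b : (nat -> nat -> C) -> C) (x : nat -> nat -> C).
Hypotheses (le : (lo <= e)%N) (rg : in_range lo e) (dx : distinct lam x).
Hypothesis (invK : exchange_inv off lo e K).
Hypothesis (inva : exchange_inv off lo e a) (invb : exchange_inv off lo e b).

(** Both differences below are combinations of the two factors treated in
    [Sym_chain_top] and [Sym_chain_bottom], with coefficients invariant under the
    exchanges; [c] is the sign which distinguishes the two cases. *)
Lemma Sym_chain_bracket (f : (nat -> nat -> C) -> C) (c : C) :
    (forall y, f y = K y * chain h off lo e y
       * ((upper y e - lower y e + h) * (a y - 2^-1 * (upper y lo + lower y lo + h))
          + c * (upper y lo - lower y lo + h)
              * (2^-1 * (upper y e + lower y e - h) - b y))) ->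
  Defs.Sym lam f x = 0.
Proof.
move=> ef.
pose K1 y := K y * (a y - 2^-1 * (upper y lo + lower y lo + h)).
pose K2 y := K y * (c * (2^-1 * (upper y e + lower y e - h) - b y)).
have := Sym_chain_top le rg dx (K := K1).
have := Sym_chain_bottom le rg dx (K := K2).
move=> e2 e1; rewrite -[RHS]addr0 -{1}e1; last first.
  move=> j y jle; rewrite /K1 invK // inva //; congr (_ * (_ - _ * (_ + _))).
  exact: exchange_inv_sum jle.
rewrite -{1}e2; last first.
  move=> j y jle; rewrite /K2 invK // invb //; congr (_ * (_ * (_ * (_ - _) - _))).
  exact: exchange_inv_sum jle.
by rewrite -SymD; apply: Sym_ext => y; rewrite ef /K1 /K2; ring.
Qed.

(** These differences occur when two neighbouring items change places and the left
    one starts at a higher, resp. lower, level than the right one. The variables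
    [a] and [b] are the ones next to the common levels below and above. *)
Lemma Sym_chain_above : Defs.Sym lam (fun y => K y * chain h off lo e y
   * ((a y - lower y lo) * (upper y e - b y)
      - (a y - upper y lo - h) * (lower y e - b y - h))) x = 0.
Proof.
by apply: (Sym_chain_bracket (c := 1)) => y; congr (_ * _); field.
Qed.

Lemma Sym_chain_below : Defs.Sym lam (fun y => K y * chain h off lo e y
   * ((a y - upper y lo - h) * (upper y e - b y)
      - (a y - lower y lo) * (lower y e - b y - h))) x = 0.
Proof.
by apply: (Sym_chain_bracket (c := -1)) => y; congr (_ * _); field.
Qed.
End Brackets.

End ChainVanishing.

(** * Configurations of items and their weights *)

Section Configurations.
Variables (R : realType) (M : nat) (h : cplx R).
Local Notation C := (cplx R).
Implicit Types (x y : nat -> nat -> C) (K : (nat -> nat -> C) -> C).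

Definition item := (nat * nat)%type.
Definition on (r : item) (j : nat) : bool := (r.1 <= j < r.2)%N.
Definition placed := (item * (nat -> C))%type.
Implicit Types (r : item) (a b p g : placed) (s : seq placed) (c : seq item).

(** The factor of a pair of variables [u] of level [j] and [v] of level [j'], when the
    item of [u] stands to the left of the item of [v]. *)
Definition edge (j j' : nat) (u v : C) : C :=
  (if j' == j.+1 then u - v - h else 1)
  * (if j == j'.+1 then v - u else 1)
  * (if (j == j') && (j <= M)%N then (v - u - h) / (v - u) else 1).

Definition inter a b : C :=
  \prod_(j < M.+2 | on a.1 j) \prod_(j' < M.+2 | on b.1 j') edge j j' (a.2 j) (b.2 j').

Definition inter_at a b (j : nat) : C :=
  (if on a.1 j && on b.1 j.+1 then a.2 j - b.2 j.+1 - h else 1)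
  * (if on b.1 j && on a.1 j.+1 then b.2 j - a.2 j.+1 else 1)
  * (if [&& on a.1 j, on b.1 j & (j <= M)%N] then (b.2 j - a.2 j - h) / (b.2 j - a.2 j)
     else 1).

Lemma prod_at_succ (n : nat) (P : pred nat) (F : nat -> C) k : (forall j, P j -> (j < n)%N) ->
  \prod_(j < n | P j) (if nat_of_ord j == k then F j else 1) = if P k then F k else 1.
Proof.
move=> bnd; rewrite -big_mkcondr /=; case: ifP => Pk.
  by rewrite (big_pred1 (Ordinal (bnd _ Pk))) // => j /=; rewrite -val_eqE /=;
     case: eqP => [->|]; rewrite ?Pk ?andbF.
by rewrite big_pred0 // => j; case: eqP => [->|]; rewrite ?Pk ?andbF.
Qed.

(** The double product shows the effect of permuting variables, the product over
    single levels serves to evaluate the interaction of two given items. *)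
Lemma interE a b : (a.1.2 <= M.+2)%N -> (b.1.2 <= M.+2)%N ->
  inter a b = \prod_(0 <= j < M.+2) inter_at a b j.
Proof.
move=> ha hb; rewrite /inter /edge.
have bnd r j : (r.2 <= M.+2)%N -> on r j -> (j < M.+2)%N.
  by move=> hr /andP[_ /leq_trans]; apply.
under [LHS]eq_bigr => j _ do rewrite 2!big_split /=.
rewrite 2!big_split /= big_mkord /inter_at 2![in RHS]big_split /=.
congr (_ * _ * _).
- rewrite big_mkcond; apply: eq_bigr => j _; case: (on a.1 j) => //=.
  by rewrite (prod_at_succ (P := on b.1) (fun j' => a.2 j - b.2 j' - h)) // => ?; apply: bnd.
- rewrite exchange_big /= big_mkcond; apply: eq_bigr => j _.
  case: (on b.1 j) => //=.
  by rewrite (prod_at_succ (P := on a.1) (fun j' => b.2 j - a.2 j')) // => ?; apply: bnd.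
rewrite big_mkcond; apply: eq_bigr => j _; case: (on a.1 j) => //=.
under eq_bigr => j' _ do rewrite eq_sym if_and.
rewrite (prod_at_succ (P := on b.1) (fun j' => if (j <= M)%N
   then (b.2 j' - a.2 j - h) / (b.2 j' - a.2 j) else 1)) => [|?]; last exact: bnd.
by rewrite if_and.
Qed.

Definition interR a j' v := \prod_(j < M.+2 | on a.1 j) edge j j' (a.2 j) v.
Definition interL b j v := \prod_(j' < M.+2 | on b.1 j') edge j j' v (b.2 j').

Lemma inter_interR a b : inter a b = \prod_(j < M.+2 | on b.1 j) interR a j (b.2 j).
Proof. exact: exchange_big. Qed.

Lemma inter_interL a b : inter a b = \prod_(j < M.+2 | on a.1 j) interL b j (a.2 j).
Proof. by []. Qed.

Definition exchanged p1 g1 p2 g2 := [/\ p1.1 = p2.1, g1.1 = g2.1 &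
  forall j, (p1.2 j = p2.2 j /\ g1.2 j = g2.2 j) \/
    [/\ on p1.1 j, on g1.1 j, p1.2 j = g2.2 j & g1.2 j = p2.2 j]].

Lemma prod_exchanged (F : nat -> C -> C) p1 g1 p2 g2 : exchanged p1 g1 p2 g2 ->
  (\prod_(j < M.+2 | on p1.1 j) F j (p1.2 j)) * (\prod_(j < M.+2 | on g1.1 j) F j (g1.2 j)) =
  (\prod_(j < M.+2 | on p2.1 j) F j (p2.2 j)) * (\prod_(j < M.+2 | on g2.1 j) F j (g2.2 j)).
Proof.
move=> [<- <- e].
have joinE (P Q : pred 'I_M.+2) (f g : 'I_M.+2 -> C) :
    (\prod_(j < M.+2 | P j) f j) * (\prod_(j < M.+2 | Q j) g j) =
    \prod_(j < M.+2) ((if P j then f j else 1) * (if Q j then g j else 1)).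
  by rewrite big_split -!big_mkcond.
rewrite !joinE; apply: eq_bigr => j _; case: (e j) => [[-> ->] //|[-> -> -> ->]].
by rewrite mulrC.
Qed.

Definition pairs := fix pairs s : C :=
  if s is a :: s' then (\prod_(b <- s') inter a b) * pairs s' else 1.

Lemma pairs_cat s1 s2 : pairs (s1 ++ s2) =
  pairs s1 * pairs s2 * \prod_(a <- s1) \prod_(b <- s2) inter a b.
Proof.
elim: s1 => [|a s1 IH] /=; first by rewrite big_nil mul1r mulr1.
by rewrite IH big_cat big_cons /=; ring.
Qed.

(** All factors of the pairs in [s1 ++ m ++ s2] except those inside [m], when [F] and [G]
    collect the factors which an item on the left, resp. right, has with [m]. *)
Definition outer s1 (F G : placed -> C) s2 : C :=
  pairs s1 * pairs s2 * (\prod_(a <- s1) \prod_(b <- s2) inter a b)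
  * (\prod_(a <- s1) F a) * (\prod_(b <- s2) G b).

Lemma pairs_one s1 m s2 : pairs (s1 ++ m :: s2) =
  outer s1 (fun a => inter a m) (fun b => inter m b) s2.
Proof.
rewrite pairs_cat /= /outer.
rewrite (_ : \prod_(a <- s1) \prod_(b <- m :: s2) inter a b =
    \prod_(a <- s1) (inter a m * \prod_(b <- s2) inter a b)); last first.
  by apply: eq_bigr => a _; rewrite big_cons.
by rewrite big_split /=; ring.
Qed.

Lemma pairs_two s1 p g s2 : pairs (s1 ++ p :: g :: s2) = inter p g *
  outer s1 (fun a => inter a p * inter a g) (fun b => inter p b * inter g b) s2.
Proof.
rewrite pairs_cat /= /outer big_cons.
rewrite (_ : \prod_(a <- s1) \prod_(b <- [:: p, g & s2]) inter a b =
    \prod_(a <- s1) (inter a p * inter a g * \prod_(b <- s2) inter a b)); last first.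
  by apply: eq_bigr => a _; rewrite !big_cons mulrA.
by rewrite !big_split /=; ring.
Qed.

Lemma outer_ext s1 F F' G G' s2 : F =1 F' -> G =1 G' ->
  outer s1 F G s2 = outer s1 F' G' s2.
Proof. by move=> eF eG; rewrite /outer (eq_bigr _ (fun a _ => eF a)) (eq_bigr _ (fun b _ => eG b)). Qed.

(** The other items see two neighbours only through the set of variables which the
    two have on each level, no matter which of the two has which variable. *)
Lemma outer_exchanged p1 g1 p2 g2 s1 s2 : exchanged p1 g1 p2 g2 ->
  outer s1 (fun a => inter a p1 * inter a g1) (fun b => inter p1 b * inter g1 b) s2 =
  outer s1 (fun a => inter a p2 * inter a g2) (fun b => inter p2 b * inter g2 b) s2.
Proof.
move=> e; apply: outer_ext => a.
  by rewrite !inter_interR (prod_exchanged _ e).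
by rewrite !inter_interL (prod_exchanged _ e).
Qed.

(** The value 0 on the free levels makes placements equal as soon as they agree on
    the occupied ones. *)
Definition place (off : nat -> nat) y r : placed :=
  (r, fun j => if on r j then y j (off j) else 0).

(** On level [j], the first [off j] variables belong to items further to the left. *)
Fixpoint fill (off : nat -> nat) y c : seq placed :=
  if c is r :: c' then place off y r :: fill (fun j => off j + on r j)%N y c' else [::].

Definition cnt c j : nat := count (fun r => on r j) c.

Lemma cnt_cat c1 c2 j : cnt (c1 ++ c2) j = (cnt c1 j + cnt c2 j)%N.
Proof. exact: count_cat. Qed.

Lemma fill_cat off y c1 c2 :
  fill off y (c1 ++ c2) = fill off y c1 ++ fill (fun j => off j + cnt c1 j)%N y c2.
Proof.
elim: c1 off => [|r c1 IH] off /=; first by congr fill; apply/funext => j; rewrite addn0.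
rewrite IH; congr (_ :: _ ++ fill _ _ _); apply/funext => j.
by rewrite -addnA.
Qed.

Lemma fill_ext off off' y y' c :
    (forall j k, (k < cnt c j)%N -> y j (off j + k)%N = y' j (off' j + k)%N) ->
  fill off y c = fill off' y' c.
Proof.
elim: c off off' => [//|r c IH] off off' e /=; congr (_ :: _).
  congr pair; apply/funext => j; case: ifP => // on_j.
  by have := e j 0%N; rewrite !addn0; apply; rewrite /= on_j.
apply: IH => j k lt_k; rewrite -!addnA; apply: e.
by rewrite /= ltn_add2l.
Qed.

Definition weight c y : C := pairs (fill (fun=> 0%N) y c).

End Configurations.

(** * Two neighbouring items changing places *)

Section Crossing.
Variables (R : realType) (M : nat) (h : cplx R).
Local Notation C := (cplx R).
Local Notation inter := (inter M h).
Local Notation weight := (weight M h).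
Implicit Types (x y : nat -> nat -> C) (c : seq item).

Definition around c1 c2 (p g : item) y : C :=
  let p' := place (cnt c1) y p in
  let g' := place (fun j => cnt c1 j + on p j)%N y g in
  outer M h (fill (fun=> 0%N) y c1) (fun a => inter a p' * inter a g')
    (fun b => inter p' b * inter g' b)
    (fill (fun j => cnt c1 j + on p j + on g j)%N y c2).

Lemma weight_two c1 c2 p g y : weight (c1 ++ p :: g :: c2) y =
  inter (place (cnt c1) y p) (place (fun j => cnt c1 j + on p j)%N y g)
  * around c1 c2 p g y.
Proof. by rewrite /weight fill_cat /= pairs_two. Qed.

Lemma place_exchanged c1 (p g : item) y :
  exchanged (place (cnt c1) y p) (place (fun j => cnt c1 j + on p j)%N y g)
            (place (fun j => cnt c1 j + on g j)%N y p) (place (cnt c1) y g).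
Proof.
split=> // j /=; case op: (on p j); case og: (on g j); rewrite /= ?addn0; by [left|right].
Qed.

(** Since variables are handed out from left to right, the two orders of the
    neighbours leave the same variables to the pair, on every level. *)
Lemma around_exchanged c1 c2 p g y : around c1 c2 g p y = around c1 c2 p g y.
Proof.
rewrite /around (outer_exchanged _ _ _ _ (place_exchanged c1 p g y)).
have -> : (fun j => cnt c1 j + on g j + on p j)%N = (fun j => cnt c1 j + on p j + on g j)%N.
  by apply/funext => j; rewrite addnAC.
by apply: outer_ext => a; rewrite mulrC.
Qed.

Lemma around_exchange c1 c2 (p g : item) y j : on p j -> on g j ->
  around c1 c2 p g (exchange (cnt c1) j y) = around c1 c2 p g y.
Proof.
move=> opj ogj; rewrite /around.
rewrite (fill_ext (off' := fun=> 0%N) (y' := y)); last first.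
  move=> i k lt_k; rewrite add0n /exchange /swap; case: eqP => // ij.
  by rewrite -ij !ltn_eqF // ltnW.
rewrite [fill _ (exchange _ _ _) c2](fill_ext (off' := (fun j => cnt c1 j + on p j + on g j)%N) (y' := y)); last first.
  move=> i k lt_k; rewrite /exchange /swap; case: eqP => // ->.
  by rewrite opj ogj -!addnA /= !gtn_eqF //; lia.
apply: outer_exchanged; split=> // i /=.
have [->|ne] := eqVneq i j.
  right; rewrite opj ogj lower_exchange addn1 upper_exchange.
  by split.
by left; rewrite exchange_level.
Qed.


Lemma prod_window (f : nat -> C) lo e n : (lo < e < n)%N ->
    (forall j, (j < lo)%N -> f j = 1) -> (forall j, (e < j)%N -> f j = 1) ->
  \prod_(0 <= j < n) f j = f lo * (\prod_(lo.+1 <= j < e) f j) * f e.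
Proof.
move=> /andP[lo_e e_n] below above.
rewrite (big_cat_nat (n := lo)) //=; last by lia.
rewrite big_nat big1 => [|j /andP[_ /below //]]; rewrite mul1r.
rewrite (big_cat_nat (n := e.+1)) //=; last by lia.
rewrite [X in _ * X]big_nat [X in _ * X]big1 => [|j /andP[/above //]]; rewrite mulr1.
by rewrite big_nat_recr //= ?(ltnW lo_e) // big_ltn.
Qed.

End Crossing.

(** Linear arithmetic decides which levels are occupied by an item. *)
Ltac decide_bool b :=
  lazymatch b with
  | true => fail
  | false => fail
  | _ => first [have -> : b = true by lia | have -> : b = false by lia]
  end.

Ltac decide_levels :=
  repeat match goal with |- context [if ?b then _ else _] => decide_bool b end;
  repeat match goal with |- context [nat_of_bool ?b] => decide_bool b end;
  rewrite /=.

Section CrossingEvaluation.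
Variables (R : realType) (M : nat) (lam : 'I_M.+1 -> nat) (h : cplx R).
Local Notation C := (cplx R).
Local Notation L := (lamsum lam).
Local Notation inter := (inter M h).
Local Notation weight := (weight M h).
Implicit Types (x y : nat -> nat -> C) (c : seq item).
Variables (c1 c2 : seq item) (al e ga : nat).
Hypotheses (al_gt0 : (0 < al)%N) (al_e : (al <= e)%N) (e_M : (e <= M)%N).
Hypotheses (ga_gt0 : (0 < ga)%N) (ga_M : (ga <= M.+1)%N).

Local Notation lower y j := (y j (cnt c1 j)).
Local Notation upper y j := (y j (cnt c1 j).+1).
Local Notation full := ((ga, M.+2) : item).
Local Notation ghost := ((al, e.+1) : item).
Local Notation lo := (maxn al ga).
Local Notation chain := (chain h (cnt c1)).

Let inter_full_ghost y :=
  inter (place (cnt c1) y full) (place (fun j => cnt c1 j + on full j)%N y ghost).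
Let inter_ghost_full y :=
  inter (place (cnt c1) y ghost) (place (fun j => cnt c1 j + on ghost j)%N y full).

(** In either order, the item on the left receives the variable [lower] and the item on
    the right the variable [upper] of a common level. Hence the interactions
    for the two orders share the factor [chain], and differ only through the
    ends of the range of common levels. *)
Lemma inter_full_ghostE y : (ga <= e)%N -> inter_full_ghost y =
  chain lo e y
  * (if (ga < al)%N then lower y al.-1 - upper y al - h
     else if (al < ga)%N then lower y ga.-1 - lower y ga else 1)
  * (upper y e - lower y e.+1).
Proof.
move=> ga_e; rewrite /inter_full_ghost interE //=; last by lia.
have [lo' loE] : exists l, lo = l.+1 by exists lo.-1; lia.
rewrite (@prod_window _ _ lo' e); first last.
- move=> j lt_j; rewrite /inter_at /place /on /=; decide_levels; by rewrite ?mulr1.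
- move=> j lt_j; rewrite /inter_at /place /on /=; decide_levels; by rewrite ?mulr1.
- by lia.
have -> : inter_at M h (place (cnt c1) y full)
    (place (fun j => cnt c1 j + on full j)%N y ghost) lo' =
    (if (ga < al)%N then lower y al.-1 - upper y al - h
     else if (al < ga)%N then lower y ga.-1 - lower y ga else 1).
  rewrite /inter_at /place /on /=.
  case: (ltngtP ga al) loE => [lt|gt|eq] loE.
  - have -> : lo' = al.-1 by lia.
    decide_levels; rewrite prednK //; decide_levels; by rewrite ?addn1 !mulr1.
  - have -> : lo' = ga.-1 by lia.
    decide_levels; rewrite prednK //; decide_levels; by rewrite ?addn0 mul1r !mulr1.
  - by decide_levels; rewrite !mulr1.
have -> : inter_at M h (place (cnt c1) y full)
    (place (fun j => cnt c1 j + on full j)%N y ghost) e =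
    (upper y e - lower y e.+1) * ((upper y e - lower y e - h) / (upper y e - lower y e)).
  by rewrite /inter_at /place /on /=; decide_levels; rewrite addn1 mul1r.
rewrite -loE (eq_big_nat _ _ (F2 := fun j =>
    (upper y j - lower y j - h) / (upper y j - lower y j)
    * ((lower y j - upper y j.+1 - h) * (upper y j - lower y j.+1)))); last first.
  move=> j /andP[lo_j j_e]; rewrite /inter_at /place /on /=; decide_levels.
  by rewrite !addn1 mulrC.
rewrite big_split /= /chain [X in _ = X * _ * _ * _]big_nat_recr //=; last by lia.
by ring.
Qed.

Lemma inter_ghost_fullE y : (ga <= e)%N -> inter_ghost_full y =
  chain lo e y
  * (if (ga < al)%N then lower y al.-1 - lower y al
     else if (al < ga)%N then lower y ga.-1 - upper y ga - h else 1)
  * (lower y e - lower y e.+1 - h).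
Proof.
move=> ga_e; rewrite /inter_ghost_full interE //=; last by lia.
have [lo' loE] : exists l, lo = l.+1 by exists lo.-1; lia.
rewrite (@prod_window _ _ lo' e); first last.
- move=> j lt_j; rewrite /inter_at /place /on /=; decide_levels; by rewrite ?mulr1.
- move=> j lt_j; rewrite /inter_at /place /on /=; decide_levels; by rewrite ?mulr1.
- by lia.
have -> : inter_at M h (place (cnt c1) y ghost)
    (place (fun j => cnt c1 j + on ghost j)%N y full) lo' =
    (if (ga < al)%N then lower y al.-1 - lower y al
     else if (al < ga)%N then lower y ga.-1 - upper y ga - h else 1).
  rewrite /inter_at /place /on /=.
  case: (ltngtP ga al) loE => [lt|gt|eq] loE.
  - have -> : lo' = al.-1 by lia.
    decide_levels; rewrite prednK //; decide_levels; by rewrite ?addn0 mul1r !mulr1.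
  - have -> : lo' = ga.-1 by lia.
    decide_levels; rewrite prednK //; decide_levels; by rewrite ?addn1 !mulr1.
  - by decide_levels; rewrite !mulr1.
have -> : inter_at M h (place (cnt c1) y ghost)
    (place (fun j => cnt c1 j + on ghost j)%N y full) e =
    (lower y e - lower y e.+1 - h) * ((upper y e - lower y e - h) / (upper y e - lower y e)).
  by rewrite /inter_at /place /on /=; decide_levels; rewrite addn1 addn0 mulr1.
rewrite -loE (eq_big_nat _ _ (F2 := fun j =>
    (upper y j - lower y j - h) / (upper y j - lower y j)
    * ((lower y j - upper y j.+1 - h) * (upper y j - lower y j.+1)))); last first.
  move=> j /andP[lo_j j_e]; rewrite /inter_at /place /on /=; decide_levels.
  by rewrite !addn1 mulrC.
rewrite big_split /= /chain [X in _ = X * _ * _ * _]big_nat_recr //=; last by lia.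
by ring.
Qed.

Lemma inter_full_ghost_apart y : (e.+1 < ga)%N -> inter_full_ghost y = 1.
Proof.
move=> e_ga; rewrite /inter_full_ghost interE //=; last by lia.
rewrite big1_seq // => j _; rewrite /inter_at /place /on /=.
by decide_levels; rewrite !mulr1.
Qed.

Lemma inter_ghost_full_apart y : (e.+1 < ga)%N -> inter_ghost_full y = 1.
Proof.
move=> e_ga; rewrite /inter_ghost_full interE //=; last by lia.
rewrite big1_seq // => j _; rewrite /inter_at /place /on /=.
by decide_levels; rewrite !mulr1.
Qed.

Lemma inter_full_ghost_touch y : ga = e.+1 ->
  inter_full_ghost y = lower y e - lower y e.+1.
Proof.
move=> ga_e; rewrite /inter_full_ghost interE //=; last by lia.
rewrite (@prod_window _ _ e.-1 e); first last.
- by move=> j lt_j; rewrite /inter_at /place /on /=; decide_levels; rewrite !mulr1.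
- by move=> j lt_j; rewrite /inter_at /place /on /=; decide_levels; rewrite !mulr1.
- by lia.
rewrite big_geq; last by lia.
by rewrite /inter_at /place /on /=; decide_levels; rewrite addn0 !mulr1 !mul1r.
Qed.

Lemma inter_ghost_full_touch y : ga = e.+1 ->
  inter_ghost_full y = lower y e - lower y e.+1 - h.
Proof.
move=> ga_e; rewrite /inter_ghost_full interE //=; last by lia.
rewrite (@prod_window _ _ e.-1 e); first last.
- by move=> j lt_j; rewrite /inter_at /place /on /=; decide_levels; rewrite !mulr1.
- by move=> j lt_j; rewrite /inter_at /place /on /=; decide_levels; rewrite !mulr1.
- by lia.
rewrite big_geq; last by lia.
by rewrite /inter_at /place /on /=; decide_levels; rewrite addn0 !mulr1 !mul1r.
Qed.

Lemma prod_merge (F : nat -> C -> C) y : ga = e.+1 ->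
  (\prod_(j < M.+2 | on full j) F j ((place (cnt c1) y full).2 j))
  * (\prod_(j < M.+2 | on ghost j)
       F j ((place (fun j => cnt c1 j + on full j)%N y ghost).2 j))
  = \prod_(j < M.+2 | on (al, M.+2) j) F j ((place (cnt c1) y (al, M.+2)).2 j).
Proof.
move=> ga_e.
rewrite big_mkcond [X in _ * X]big_mkcond [RHS]big_mkcond -big_split /=.
apply: eq_bigr => j _; rewrite /on /= ga_e; have := ltn_ord j.
case: (leqP al j) => alj; case: (leqP e.+1 j) => ej jM; try lia; decide_levels;
  by rewrite ?addn0 ?mulr1 ?mul1r.
Qed.

Lemma around_merge y : ga = e.+1 ->
  around M h c1 c2 full ghost y = weight (c1 ++ (al, M.+2) :: c2) y.
Proof.
move=> ga_e; rewrite /weight fill_cat /= pairs_one /around.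
have -> : (fun j => cnt c1 j + on full j + on ghost j)%N =
          (fun j => cnt c1 j + on ((al, M.+2) : item) j)%N.
  apply/funext => j; rewrite -addnA; congr (_ + _)%N; rewrite ga_e /on /=.
  by lia.
apply: outer_ext => a.
  by rewrite !inter_interR -(prod_merge _ _ ga_e).
by rewrite !inter_interL -(prod_merge _ _ ga_e).
Qed.

(** When the item on the left starts where the ghost ends, the two together
    look like one longer item from everywhere else, so that placing the ghost
    next to it multiplies the weight by one linear factor. *)
Lemma weight_full_ghost_touch y : ga = e.+1 ->
  weight (c1 ++ full :: ghost :: c2) y =
  (lower y e - lower y e.+1) * weight (c1 ++ (al, M.+2) :: c2) y.
Proof.
by move=> ga_e; rewrite weight_two -/(inter_full_ghost y) inter_full_ghost_touch // around_merge.
Qed.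

Lemma weight_ghost_full y :
  weight (c1 ++ ghost :: full :: c2) y = inter_ghost_full y * around M h c1 c2 full ghost y.
Proof. by rewrite weight_two around_exchanged. Qed.

Lemma weight_ghost_full_touch y : ga = e.+1 ->
  weight (c1 ++ ghost :: full :: c2) y =
  (lower y e - lower y e.+1 - h) * weight (c1 ++ (al, M.+2) :: c2) y.
Proof. by move=> ga_e; rewrite weight_ghost_full inter_ghost_full_touch // around_merge. Qed.

(** If the full item starts below the end of the ghost, the two orders have the same
    symmetrization by the vanishing of the chains; if it starts above, there is
    no interaction at all. If it starts exactly where the ghost ends, the two
    interactions are linear factors which differ by [h], and the rest is the
    weight with the two items joined. *)
Lemma crossing x : distinct lam x ->
    (forall j, (1 <= j <= M)%N -> cnt (c1 ++ full :: ghost :: c2) j = L j) ->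
  Defs.Sym lam (weight (c1 ++ full :: ghost :: c2)) x
  - Defs.Sym lam (weight (c1 ++ ghost :: full :: c2)) x
  = if ga == e.+1 then h * Defs.Sym lam (weight (c1 ++ (al, M.+2) :: c2)) x else 0.
Proof.
move=> dx cntL; rewrite -SymB.
case: (ltngtP ga e.+1) => [ga_e|ga_e|ga_e]; last first.
- rewrite -SymZ; apply: Sym_ext => y.
  by rewrite weight_full_ghost_touch // weight_ghost_full_touch //; ring.
- rewrite -[RHS](Sym0 lam x); apply: Sym_ext => y.
  rewrite weight_two -/(inter_full_ghost y) weight_ghost_full.
  by rewrite inter_full_ghost_apart // inter_ghost_full_apart // subrr.
have lo_e : (lo <= e)%N by rewrite geq_max al_e.
have rg j : (lo <= j <= e)%N -> ((1 <= j <= M) && ((cnt c1 j).+1 < L j))%N.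
  move=> jle; have jM : (1 <= j <= M)%N by lia.
  rewrite jM -cntL // cnt_cat /= /on /=.
  by decide_levels; lia.
have invK : exchange_inv (cnt c1) lo e (around M h c1 c2 full ghost).
  by move=> j y jle; apply: around_exchange; rewrite /on /=; lia.
have levelP j : ((j < lo) || (e < j))%N ->
    exchange_inv (cnt c1) lo e (fun y => lower y j).
  by move=> jo i y ile; rewrite exchange_level //; lia.
pose diff y := inter_full_ghost y - inter_ghost_full y.
transitivity (Defs.Sym lam (fun y => around M h c1 c2 full ghost y * diff y) x).
  apply: Sym_ext => y; rewrite weight_two -/(inter_full_ghost y) weight_ghost_full /diff.
  by ring.
rewrite /diff; case: (ltngtP ga al) => [lt|gt|eq].
- have lo_al : lo = al by apply/maxn_idPl/ltnW.
  rewrite -(Sym_chain_below h lo_e rg dx invK (levelP al.-1 _) (levelP e.+1 _)).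
  + apply: Sym_ext => y; rewrite inter_full_ghostE // inter_ghost_fullE // lt lo_al.
    by ring.
  + by lia.
  + by rewrite ltnSn orbT.
- have lo_ga : lo = ga by apply/maxn_idPr/ltnW.
  rewrite -(Sym_chain_above h lo_e rg dx invK (levelP ga.-1 _) (levelP e.+1 _)).
  + apply: Sym_ext => y; rewrite inter_full_ghostE // inter_ghost_fullE //.
    by rewrite ltnNge (ltnW gt) gt lo_ga /=; ring.
  + by lia.
  + by rewrite ltnSn orbT.
rewrite -(Sym_chain_top h lo_e rg dx invK).
apply: Sym_ext => y; rewrite inter_full_ghostE // inter_ghost_fullE // eq ltnn.
by ring.
Qed.

End CrossingEvaluation.

(** * Weights sorted by levels *)

Section WeightOfConfiguration.
Variables (R : realType) (M : nat) (h : cplx R).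
Local Notation C := (cplx R).
Local Notation inter := (inter M h).
Local Notation weight := (weight M h).
Implicit Types (x y : nat -> nat -> C) (c : seq item) (s : seq (placed R)).

Local Notation item_at c k := (nth ((0, 0) : item)%N c k).

Definition positions c j : seq nat :=
  [seq k <- iota 0 (size c) | on (item_at c k) j].

Lemma size_positions c j : size (positions c j) = cnt c j.
Proof.
rewrite size_filter /cnt -[in RHS](mkseq_nth ((0, 0) : item)%N c) /mkseq count_map.
exact: eq_count.
Qed.

(** An item is the [a]-th one of a level exactly when [a] items before it occupy
    this level; this changes a product over the variables of a level into a
    product over items. *)
Lemma prod_positions c j (F : nat -> nat -> C) :
  \prod_(0 <= a < cnt c j) F (nth 0%N (positions c j) a) a =
  \prod_(0 <= k < size c | on (item_at c k) j) F k (cnt (take k c) j).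
Proof.
elim/last_ind: c => [|c r IH]; first by rewrite !big_geq.
have posE : positions (rcons c r) j =
    positions c j ++ (if on r j then [:: size c] else [::]).
  rewrite /positions size_rcons -addn1 iotaD filter_cat add0n /=.
  rewrite nth_rcons ltnn eqxx; congr (_ ++ _).
  by apply: eq_in_filter => k; rewrite mem_iota add0n nth_rcons => /andP[_ ->].
have cntE : cnt (rcons c r) j = (cnt c j + on r j)%N.
  by rewrite -cats1 cnt_cat /= addn0.
rewrite posE cntE size_rcons [RHS]big_mkcond big_nat_recr //= -big_mkcond.
rewrite nth_rcons ltnn eqxx -cats1 take_size_cat //.
have -> : \prod_(0 <= k < size c | on (item_at (c ++ [:: r]) k) j)
    F k (cnt (take k (c ++ [:: r])) j) =
    \prod_(0 <= k < size c | on (item_at c k) j) F k (cnt (take k c) j).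
  rewrite big_nat_cond [RHS]big_nat_cond; apply: eq_big => [k|k /andP[/andP[_ lt_k] _]].
    by case: (ltnP k (size c)) => lt_k; rewrite ?andbF ?andFb // nth_cat lt_k.
  by rewrite takel_cat // ltnW.
rewrite -IH; case: ifP => on_r; last by rewrite addn0 cats0 mulr1.
rewrite addn1 big_nat_recr //= nth_cat size_positions ltnn subnn /=; congr (_ * _).
by apply: eq_big_nat => a /andP[_ lt_a]; rewrite nth_cat size_positions lt_a.
Qed.

Lemma sum_positions c j (f : nat -> C) :
  \sum_(0 <= k < size c | on (item_at c k) j) f (cnt (take k c) j) =
  \sum_(0 <= a < cnt c j) f a.
Proof.
elim/last_ind: c => [|c r IH]; first by rewrite !big_geq.
rewrite size_rcons [LHS]big_mkcond big_nat_recr //= -big_mkcond.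
rewrite nth_rcons ltnn eqxx -cats1 take_size_cat // cnt_cat /= addn0.
have -> : \sum_(0 <= k < size c | on (item_at (c ++ [:: r]) k) j)
    f (cnt (take k (c ++ [:: r])) j) =
    \sum_(0 <= k < size c | on (item_at c k) j) f (cnt (take k c) j).
  rewrite big_nat_cond [RHS]big_nat_cond; apply: eq_big => [k|k /andP[/andP[_ lt_k] _]].
    by case: (ltnP k (size c)) => lt_k; rewrite ?andbF ?andFb // nth_cat lt_k.
  by rewrite takel_cat // ltnW.
rewrite IH; case: ifP => on_r; last by rewrite !addn0 addr0.
by rewrite addn1 big_nat_recr.
Qed.

(** Along one level, the order of the variables is the order of the items. *)
Lemma rank_lt c j k k' : (k < size c)%N -> (k' < size c)%N ->
    on (item_at c k) j -> on (item_at c k') j ->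
  (cnt (take k c) j < cnt (take k' c) j)%N = (k < k')%N.
Proof.
have mono i i' : (i < i')%N -> (i' < size c)%N -> on (item_at c i) j ->
    (cnt (take i c) j < cnt (take i' c) j)%N.
  move=> lt_ii' lt_i' oni.
  have lt_i : (i < size c)%N by apply: ltn_trans lt_i'.
  have -> : take i' c = take i.+1 c ++ take (i' - i.+1) (drop i.+1 c).
    by rewrite -takeD subnKC.
  rewrite cnt_cat (take_nth ((0, 0) : item)%N) // -cats1 cnt_cat /= oni.
  by rewrite addn0 addn1 addSn ltnS leq_addr.
move=> ltk ltk' onk onk'; case: (ltngtP k k') => [lt|gt|->]; last exact: ltnn.
  exact: mono.
by apply/negbTE; rewrite -leqNgt ltnW // mono.
Qed.

Lemma pairs_nth a s : pairs M h s =
  \prod_(0 <= k < size s) \prod_(0 <= k' < size s | (k < k')%N)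
    inter (nth a s k) (nth a s k').
Proof.
elim: s => [|b s IH]; first by rewrite big_geq.
rewrite /= big_nat_recl //= [X in _ = X * _]big_mkcond /= [X in _ = X * _]big_nat_recl //=.
rewrite mul1r; congr (_ * _).
  by rewrite (big_nth a).
rewrite IH; apply: eq_bigr => k _.
by rewrite [RHS]big_mkcond big_nat_recl //= mul1r -big_mkcond.
Qed.

Lemma size_fill off y c : size (fill off y c) = size c.
Proof. by elim: c off => //= r c IH off; rewrite IH. Qed.

Lemma nth_fill a off y c k : (k < size c)%N ->
  nth a (fill off y c) k = place (fun j => off j + cnt (take k c) j)%N y (item_at c k).
Proof.
elim: c off k => [//|r c IH] off [|k] lt_k.
  rewrite take0 (_ : (fun j => _) = off) //.
  by apply/funext => j; rewrite addn0.
rewrite [LHS]IH // (_ : (fun j => _) = (fun j => off j + cnt (take k.+1 (r :: c)) j)%N) //.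
by apply/funext => j; rewrite -addnA.
Qed.

(** Each pair of variables of adjacent levels is counted at the one of lower level, in
    the first or second product according to which item stands on the left; a
    pair on the same level is counted at the item on the left. *)
Lemma weight_levels c y : all (fun r : item => (0 < r.1)%N && (r.2 == M.+2)) c ->
  weight c y =
  \prod_(1 <= j < M.+1) \prod_(0 <= a < cnt c j)
    ((\prod_(0 <= b < cnt c j.+1
        | (nth 0%N (positions c j.+1) b < nth 0%N (positions c j) a)%N)
        (y j a - y j.+1 b))
     * (\prod_(0 <= d < cnt c j.+1
        | (nth 0%N (positions c j) a < nth 0%N (positions c j.+1) d)%N)
        (y j a - y j.+1 d - h))
     * \prod_(a.+1 <= b < cnt c j) ((y j b - y j a - h) / (y j b - y j a))).
Proof.
move=> /allP full.
have fullP k : (k < size c)%N -> (0 < (item_at c k).1)%N /\ (item_at c k).2 = M.+2.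
  by move=> lt_k; move: (full _ (mem_nth ((0, 0) : item)%N lt_k)) => /andP[-> /eqP].
pose v k j := y j (cnt (take k c) j).
pose o k j := on (item_at c k) j.
pose N := size c.
transitivity (\prod_(1 <= j < M.+1) \prod_(0 <= k < N) \prod_(0 <= k' < N)
  ((if [&& o k j, o k' j.+1 & (k' < k)%N] then v k j - v k' j.+1 else 1)
   * (if [&& o k j, o k' j.+1 & (k < k')%N] then v k j - v k' j.+1 - h else 1)
   * (if [&& o k j, o k' j & (k < k')%N] then (v k' j - v k j - h) / (v k' j - v k j)
      else 1))); last first.
  apply: eq_big_nat => j jM.
  rewrite (prod_positions c j (fun p a =>
    ((\prod_(0 <= b < cnt c j.+1 | (nth 0%N (positions c j.+1) b < p)%N)
        (y j a - y j.+1 b))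
     * (\prod_(0 <= d < cnt c j.+1 | (p < nth 0%N (positions c j.+1) d)%N)
        (y j a - y j.+1 d - h))
     * \prod_(a.+1 <= b < cnt c j) ((y j b - y j a - h) / (y j b - y j a))))).
  rewrite [RHS]big_mkcond /= [LHS]big_nat_cond [RHS]big_nat_cond.
  apply: eq_bigr => k /andP[/andP[_ ltk] _].
  rewrite -/(o k j); case ok: (o k j); last by rewrite big1 //= => k' _; rewrite !mulr1.
  rewrite 2!big_split /=; congr (_ * _ * _).
  - rewrite [RHS]big_mkcond (prod_positions c j.+1 (fun p b => if (p < k)%N
      then y j (cnt (take k c) j) - y j.+1 b else 1)) [RHS]big_mkcond.
    by apply: eq_bigr => k' _; rewrite -if_and.
  - rewrite [RHS]big_mkcond (prod_positions c j.+1 (fun p b => if (k < p)%N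
      then y j (cnt (take k c) j) - y j.+1 b - h else 1)) [RHS]big_mkcond.
    by apply: eq_bigr => k' _; rewrite -if_and.
  transitivity (\prod_(0 <= b < cnt c j) if (cnt (take k c) j < b)%N
      then (y j b - y j (cnt (take k c) j) - h) / (y j b - y j (cnt (take k c) j)) else 1);
    last by rewrite [RHS](big_nat_widenl _ 0) //= [RHS]big_mkcond.
  rewrite (prod_positions c j (fun p b => if (cnt (take k c) j < b)%N
      then (y j b - y j (cnt (take k c) j) - h) / (y j b - y j (cnt (take k c) j)) else 1)).
  rewrite [RHS]big_mkcond !big_nat; apply: eq_bigr => k' /andP[_ ltk'].
  rewrite -/(o k' j); case ok': (o k' j) => //=.
  by rewrite rank_lt.
rewrite /weight (pairs_nth (((0, 0) : item)%N, fun=> 0)) size_fill.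
transitivity (\prod_(0 <= j < M.+2) \prod_(0 <= k < N) \prod_(0 <= k' < N)
  ((if [&& o k' j, o k j.+1 & (k < k')%N] then v k' j - v k j.+1 else 1)
   * (if [&& o k j, o k' j.+1 & (k < k')%N] then v k j - v k' j.+1 - h else 1)
   * (if [&& o k j, o k' j & (k < k')%N] && (j <= M)%N
      then (v k' j - v k j - h) / (v k' j - v k j) else 1))).
  rewrite [RHS]exchange_big_nat /=.
  rewrite big_nat [RHS]big_nat; apply: eq_bigr => k /andP[_ ltk].
  rewrite [RHS]exchange_big_nat /= [LHS]big_mkcond.
  rewrite big_nat [RHS]big_nat; apply: eq_bigr => k' /andP[_ ltk'].
  case: ifP => lt_kk'; last first.
    by rewrite big1 // => j _; rewrite !andbF !mulr1.
  have [[_ hk] [_ hk']] := (fullP _ ltk, fullP _ ltk').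
  rewrite interE !nth_fill //= ?hk ?hk' //.
  apply: eq_bigr => j _; rewrite /inter_at /= !andbT.
  rewrite -!/(o _ _) -!/(v _ _).
  by case: (o k j); case: (o k' j); case: (o k j.+1); case: (o k' j.+1);
    rewrite /= [X in X * _ = _]mulrC.
have o0 k : (k < N)%N -> o k 0%N = false.
  by move=> ltk; rewrite /o /on; have [k0 _] := fullP k ltk; rewrite leqNgt k0.
have oM k : (k < N)%N -> o k M.+2 = false.
  by move=> ltk; rewrite /o /on; have [_ ->] := fullP k ltk; rewrite ltnn andbF.
rewrite big_nat_recr //= big_ltn // [X in X * _ * _]big_nat [X in X * _ * _]big1; last first.
  move=> k /andP[_ ltk]; rewrite big_nat big1 // => k' /andP[_ ltk'].
  by rewrite !o0 // !mulr1.
rewrite [X in _ * X]big_nat [X in _ * X]big1; last first.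
  move=> k /andP[_ ltk]; rewrite big_nat big1 // => k' /andP[_ ltk'].
  by rewrite !oM // ltnn !(andbF, andFb) !mulr1.
rewrite mul1r mulr1; apply: eq_big_nat => j /andP[_ jM].
have splitE (t1 t2 t3 : nat -> nat -> C) :
    \prod_(0 <= k < N) \prod_(0 <= k' < N) (t1 k k' * t2 k k' * t3 k k') =
    (\prod_(0 <= k < N) \prod_(0 <= k' < N) t1 k k')
    * (\prod_(0 <= k < N) \prod_(0 <= k' < N) t2 k k')
    * (\prod_(0 <= k < N) \prod_(0 <= k' < N) t3 k k').
  by rewrite -!big_split; apply: eq_bigr => k _; rewrite -!big_split.
rewrite !splitE; congr (_ * _ * _).
  exact: exchange_big_nat.
by apply: eq_bigr => k _; apply: eq_bigr => k' _; rewrite (_ : (j <= M)%N) ?andbT.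
Qed.

End WeightOfConfiguration.

(** * A ghost at either end of a configuration *)

Section GhostAtTheEnds.
Variables (R : realType) (M : nat) (lam : 'I_M.+1 -> nat) (h : cplx R).
Local Notation C := (cplx R).
Local Notation L := (lamsum lam).
Local Notation inter := (inter M h).
Local Notation weight := (weight M h).
Implicit Types (x y : nat -> nat -> C) (c : seq item) (a b : placed R).

Lemma prod_fill off y c (F : nat -> C -> C) :
  \prod_(a <- fill off y c) \prod_(j < M.+2 | on a.1 j) F j (a.2 j) =
  \prod_(j < M.+2) \prod_(0 <= r < cnt c j) F j (y j (off j + r)%N).
Proof.
elim: c off => [|r c IH] off /=.
  by rewrite big_nil big1 // => j _; rewrite big_geq.
rewrite big_cons IH [X in X * _]big_mkcond -big_split; apply: eq_bigr => j _ /=.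
case: (on r j) => /=; last by rewrite mul1r add0n; apply: eq_bigr => k _; rewrite addn0.
rewrite add1n big_nat_recl // addn0; congr (_ * _).
by apply: eq_bigr => k _; rewrite -addnA add1n.
Qed.

(** The interaction of one variable [v] of level [j] with all the others, when [f1],
    [f2], [f3] are the factors for the level below, the level above and the
    same level. *)
Lemma prod_neighbours j (m : nat -> nat) (f1 f2 f3 : C -> C -> C) y v :
    (0 < j <= M)%N ->
  \prod_(j' < M.+2) \prod_(0 <= r < m j')
    ((if j == j'.+1 then f1 (y j' r) v else 1) * (if j.+1 == j' then f2 v (y j' r) else 1)
     * (if j == j' then f3 (y j' r) v else 1)) =
  (\prod_(0 <= r < m j.-1) f1 (y j.-1 r) v) * (\prod_(0 <= r < m j.+1) f2 v (y j.+1 r))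
  * \prod_(0 <= r < m j) f3 (y j r) v.
Proof.
move=> /andP[j_gt0 jM].
under [LHS]eq_bigr do rewrite 2!big_split /=.
rewrite 2!big_split /=.
have single k (F : nat -> nat -> C) : (k < M.+2)%N ->
    \prod_(j' < M.+2) \prod_(0 <= r < m j') (if nat_of_ord j' == k then F j' r else 1) =
    \prod_(0 <= r < m k) F k r.
  move=> lt_k; rewrite (bigD1 (Ordinal lt_k)) //= eqxx [X in _ * X]big1 ?mulr1 // => i ne.
  by rewrite big1 // => r _; rewrite -val_eqE /= in ne *; rewrite (negPf ne).
congr (_ * _ * _).
- rewrite -(single _ (fun j' r => f1 (y j' r) v)); last by lia.
  apply: eq_bigr => j' _; apply: eq_bigr => r _.
  by have -> : (j == j'.+1) = (nat_of_ord j' == j.-1) by lia.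
- rewrite -(single _ (fun j' r => f2 v (y j' r))); last by lia.
  by apply: eq_bigr => j' _; apply: eq_bigr => r _; rewrite eq_sym.
rewrite -(single _ (fun j' r => f3 (y j' r) v)); last by lia.
by apply: eq_bigr => j' _; apply: eq_bigr => r _; rewrite eq_sym.
Qed.

Section Ends.
Variables (al be : nat) (c : seq item).
Hypotheses (al_be : (al < be)%N) (be_M : (be <= M)%N).
Local Notation ghost := ((al.+1, be.+1) : item).
Hypothesis cntL : forall j, (j <= M.+1)%N -> (cnt c j + on ghost j)%N = L j.
Hypothesis top_gt0 : (0 < L be.+1)%N.
Local Notation last_var y i := (y i (L i).-1).

Lemma cnt_ghost j : (al < j <= be)%N -> cnt c j = (L j).-1.
Proof. by move=> jin; rewrite -cntL ?/on /= ?ltnS ?jin ?addn1 //; lia. Qed.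

Lemma cnt_no_ghost j : (j <= M.+1)%N -> ~~ (al < j <= be)%N -> cnt c j = L j.
Proof. by move=> jM jout; rewrite -cntL // /on /= ltnS (negPf jout) addn0. Qed.

(** The last variable of a level belongs to the ghost on the levels of the ghost, and to
    one of the other items on the two adjacent levels; there its factor is split
    off. This accounts for the special factors of [Afun] and [Bfun]. *)
Lemma prod_ghost (f1 f2 f3 : C -> C -> C) y :
  \prod_(al.+1 <= i < be.+1)
    ((\prod_(0 <= r < cnt c i.-1) f1 (y i.-1 r) (last_var y i))
     * (\prod_(0 <= r < cnt c i.+1) f2 (last_var y i) (y i.+1 r))
     * \prod_(0 <= r < cnt c i) f3 (y i r) (last_var y i))
  = (if L al == 0%N then 1 else f1 (last_var y al) (last_var y al.+1))
    * (\prod_(al.+1 <= i < be.+1) \prod_(0 <= r < (L i.-1).-1) f1 (y i.-1 r) (last_var y i))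
    * f2 (last_var y be) (last_var y be.+1)
    * (\prod_(al.+1 <= i < be.+1) \prod_(0 <= r < (L i.+1).-1) f2 (last_var y i) (y i.+1 r))
    * \prod_(al.+1 <= i < be.+1) \prod_(0 <= r < (L i).-1) f3 (y i r) (last_var y i).
Proof.
rewrite 2!big_split /=.
have -> : \prod_(al.+1 <= i < be.+1) \prod_(0 <= r < cnt c i) f3 (y i r) (last_var y i) =
    \prod_(al.+1 <= i < be.+1) \prod_(0 <= r < (L i).-1) f3 (y i r) (last_var y i).
  by apply: eq_big_nat => i iin; rewrite cnt_ghost //; lia.
congr (_ * _); rewrite -mulrA; congr (_ * _).
  rewrite big_ltn 1?[X in _ = _ * X]big_ltn //= mulrA; congr (_ * _).
    rewrite cnt_no_ghost; [|lia|lia].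
    case: eqP => [->|/eqP]; first by rewrite !big_geq // mulr1.
    by rewrite -lt0n => L0; rewrite -{1}(prednK L0) big_nat_recr //= mulrC.
  by apply: eq_big_nat => i iin; rewrite cnt_ghost //; lia.
rewrite big_nat_recr 1?[X in _ = _ * X]big_nat_recr //= mulrCA; congr (_ * _).
  by apply: eq_big_nat => i iin; rewrite cnt_ghost //; lia.
rewrite cnt_no_ghost; [|lia|lia].
by rewrite -{1}(prednK top_gt0) big_nat_recr //= mulrC.
Qed.

Lemma prod_on (lo hi : nat) (F : nat -> C) : (hi <= M.+2)%N ->
  \prod_(j < M.+2 | on (lo, hi) j) F j = \prod_(lo <= j < hi) F j.
Proof.
move=> hiM; rewrite (big_nat_widenl lo 0) // (big_nat_widen 0 hi M.+2) // big_mkord.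
by apply: eq_bigl => j; rewrite /on /= andbC.
Qed.

Lemma prod_edges (w : nat -> C) (E : nat -> nat -> C -> C -> C) (f1 f2 f3 : C -> C -> C) y :
    (forall i, (al < i <= be)%N -> w i = last_var y i) ->
    (forall i j u v, (i <= M)%N -> E i j u v =
       (if i == j.+1 then f1 u v else 1) * (if i.+1 == j then f2 v u else 1)
       * (if i == j then f3 u v else 1)) ->
  \prod_(j < M.+2) \prod_(0 <= r < cnt c j) \prod_(i < M.+2 | on ghost i) E i j (y j r) (w i) =
  (if L al == 0%N then 1 else f1 (last_var y al) (last_var y al.+1))
    * (\prod_(al.+1 <= i < be.+1) \prod_(0 <= r < (L i.-1).-1) f1 (y i.-1 r) (last_var y i))
    * f2 (last_var y be) (last_var y be.+1)
    * (\prod_(al.+1 <= i < be.+1) \prod_(0 <= r < (L i.+1).-1) f2 (last_var y i) (y i.+1 r))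
    * \prod_(al.+1 <= i < be.+1) \prod_(0 <= r < (L i).-1) f3 (y i r) (last_var y i).
Proof.
move=> wE EE; rewrite -prod_ghost.
under [LHS]eq_bigr do rewrite exchange_big /=.
rewrite exchange_big /= -(@prod_on al.+1 be.+1) ?ltnS; last by lia.
apply: eq_bigr => i /andP[/= al_i i_be].
rewrite -(prod_neighbours _ f1 f2 f3); last by lia.
apply: eq_bigr => j _; apply: eq_bigr => r _.
by rewrite EE ?wE //; lia.
Qed.

(** A ghost at the end of a configuration carries the last variable of each of its
    levels; this is the origin of the factor [Bfun] of the discrete differentials. *)
Lemma weight_ghost_last y : weight (c ++ [:: ghost]) y = weight c y * Bfun h lam al.+1 be.+1 y.
Proof.
rewrite /weight fill_cat pairs_cat /= big_nil !mulr1; congr (_ * _).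
rewrite (eq_bigr (fun a => \prod_(j < M.+2 | on a.1 j)
    interL M h (place (cnt c) y ghost) j (a.2 j))) => [|a _]; last first.
  by rewrite big_cons big_nil mulr1.
rewrite (prod_fill _ _ _ (interL M h (place (cnt c) y ghost))) /Bfun /interL.
apply: (prod_edges (E := fun i j u v => edge M h j i u v)
  (f1 := fun u v => u - v - h) (f2 := fun v u => v - u)
  (f3 := fun u v => (v - u - h) / (v - u))) => [i iin|i j u v iM] /=.
  by rewrite /on /= ltnS iin cnt_ghost.
rewrite /edge [j == i]eq_sym [j == i.+1]eq_sym.
by have -> : (i == j) && (j <= M)%N = (i == j) by lia.
Qed.

(** A ghost at the front of a configuration carries the first variable of each of its
    levels; up to a rotation of the variables this gives the factor [Afun]. *)
Lemma weight_ghost_first y y' :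
    (forall j r, (r < cnt c j)%N -> y' j (on ghost j + r)%N = y j r) ->
    (forall j, (al < j <= be)%N -> y' j 0%N = last_var y j) ->
  weight (ghost :: c) y' = weight c y * Afun h lam al.+1 be.+1 y.
Proof.
move=> tailE headE; rewrite /weight /=.
rewrite (fill_ext (off' := fun=> 0%N) (y' := y)) => [|j k lt_k]; last first.
  by rewrite !add0n tailE.
rewrite mulrC; congr (_ * _).
rewrite (eq_bigr (fun a => \prod_(j < M.+2 | on a.1 j)
    interR M h (place (fun=> 0%N) y' ghost) j (a.2 j))) => [|a _]; last first.
  exact: inter_interR.
rewrite (prod_fill _ _ _ (interR M h (place (fun=> 0%N) y' ghost))) /Afun /interR.
apply: (prod_edges (E := fun i j u v => edge M h i j v u)
  (f1 := fun u v => u - v) (f2 := fun v u => v - u - h)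
  (f3 := fun u v => (u - v - h) / (u - v))) => [i iin|i j u v iM] /=.
  by rewrite /on /= ltnS iin headE.
rewrite /edge [i.+1 == j]eq_sym [X in X * _]mulrC.
by have -> : (i == j) && (i <= M)%N = (i == j) by lia.
Qed.

End Ends.

(** The last variable becomes the first one, and all others move up by one place. *)
Definition rotation k : 'S_k := perm (@ord_pred_inj k).

Definition rotate (l : seq nat) x :=
  foldr (fun j y => permute j (rotation (L j)) y) x l.

Lemma Sym_rotate l f x : all (fun j => 1 <= j <= M)%N l ->
  Defs.Sym lam (fun y => f (rotate l y)) x = Defs.Sym lam f x.
Proof.
elim: l f => [//|j l IH] f /= /andP[jM lM].
by rewrite (IH (fun y => f (permute j _ y))) // Sym_permute.
Qed.

Lemma rotate_level l x j : uniq l ->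
  rotate l x j = if j \in l then permute j (rotation (L j)) x j else x j.
Proof.
elim: l => [//|i l IH] /= /andP[il ul]; apply/funext => a.
rewrite inE; have [ij|ne] := eqVneq j i; last by rewrite permuteE_out ?IH //; left.
rewrite -ij in il *; rewrite /= -/(rotate l x) /permute eqxx.
by case: insub => [u|]; rewrite IH // (negPf il).
Qed.

Lemma rotate0 l x j : uniq l -> j \in l -> (0 < L j)%N -> rotate l x j 0%N = x j (L j).-1.
Proof.
move=> ul jl L0; rewrite rotate_level // jl (permuteE_in _ _ _ L0) permE /=.
by rewrite add0n modn_small // prednK.
Qed.

Lemma rotateS l x j r : uniq l -> j \in l -> (r.+1 < L j)%N -> rotate l x j r.+1 = x j r.
Proof.
move=> ul jl Lr; rewrite rotate_level // jl (permuteE_in _ _ _ Lr) permE /=.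
by rewrite modnDr modn_small // ltnW.
Qed.

End GhostAtTheEnds.

(** * Configurations of basis vectors *)

Section ConfigurationsOfBasisVectors.
Variables (R : realType) (M n : nat) (h : cplx R).
Local Notation C := (cplx R).
Local Notation inter := (inter M h).
Local Notation weight := (weight M h).
Local Notation state := {ffun 'I_n -> 'I_M.+1}.
Implicit Types (x y : nat -> nat -> C) (s : state).

Definition conf s : seq item := [seq ((s l).+1, M.+2) | l <- enum 'I_n].

Definition has_weight (lam : 'I_M.+1 -> nat) s :=
  forall m, #|[pred l | s l == m]| = lam m.

Lemma size_conf s : size (conf s) = n.
Proof. by rewrite size_map size_enum_ord. Qed.

Lemma nth_conf d s (l : 'I_n) : nth d (conf s) l = ((s l).+1, M.+2).
Proof. by rewrite (nth_map l) ?size_enum_ord // nth_ord_enum. Qed.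

Lemma conf_set_at s (l : 'I_n) m :
  conf (set_at s l m) = take l (conf s) ++ (m.+1, M.+2) :: drop l.+1 (conf s).
Proof.
transitivity (set_nth (0, 0)%N (conf s) l (m.+1, M.+2)).
  apply: (@eq_from_nth _ (0, 0)%N).
    by rewrite size_set_nth !size_conf; apply/esym/maxn_idPr.
  move=> k; rewrite size_conf => lt_k; rewrite nth_set_nth /=.
  rewrite (nth_conf _ _ (Ordinal lt_k)) ffunE -val_eqE /=; case: ifP => // _.
  by rewrite (nth_conf _ _ (Ordinal lt_k)).
by rewrite set_nthE size_conf ltn_ord.
Qed.

Lemma conf_split s (l : 'I_n) :
  conf s = take l (conf s) ++ ((s l).+1, M.+2) :: drop l.+1 (conf s).
Proof.
rewrite -conf_set_at; congr conf; apply/ffunP => k; rewrite ffunE.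
by case: eqP => [->|].
Qed.

Lemma set_at_twice s l m m' : set_at (set_at s l m) l m' = set_at s l m'.
Proof. by apply/ffunP => k; rewrite !ffunE; case: eqP. Qed.

Lemma set_at_id s l m : s l = m -> set_at s l m = s.
Proof. by move=> <-; apply/ffunP => k; rewrite ffunE; case: eqP => [->|]. Qed.

Lemma cnt_conf_card s j : (j <= M.+1)%N -> cnt (conf s) j = #|[pred l | (s l < j)%N]|.
Proof.
move=> jM; rewrite /cnt count_map cardE size_filter -enumT; apply: eq_count => l /=.
by rewrite /on /= !inE ltnS jM andbT.
Qed.

Lemma cnt_conf lam s j : has_weight lam s -> (j <= M.+1)%N -> cnt (conf s) j = lamsum lam j.
Proof.
move=> sw jM; rewrite cnt_conf_card // -sum1_card /lamsum.
rewrite (partition_big s (fun k => k < j)%N) //=; apply: eq_bigr => k kj.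
rewrite -sw -sum1_card; apply: eq_bigl => l; rewrite !inE.
by case: eqP => [->|]; rewrite ?kj ?andbF.
Qed.

Lemma has_weight_gt0 lam s l m : has_weight lam s -> s l = m -> (0 < lam m)%N.
Proof. by move=> sw slm; rewrite -sw; apply/card_gt0P; exists l; rewrite inE slm. Qed.

(** Moving one element from block [al] to block [be] frees one variable on each of the
    levels [al + 1], ..., [be]; these are the levels of the ghost. *)
Lemma lamsum_move (lam : 'I_M.+1 -> nat) (al be : 'I_M.+1) j : (al < be)%N -> (0 < lam al)%N ->
  (lamsum (lam_move lam al be) j + on (al.+1, be.+1) j)%N = lamsum lam j.
Proof.
move=> al_be lam_al.
have single (m : 'I_M.+1) : (\sum_(k < M.+1 | (k < j)%N) (k == m) = (m < j))%N.
  rewrite big_mkcond (bigD1 m) //= eqxx big1 ?addn0; first by case: ifP.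
  by move=> k /negPf ->; case: ifP.
have : (lamsum (lam_move lam al be) j + (al < j) = lamsum lam j + (be < j))%N.
  rewrite /lamsum -!single -!big_split /=; apply: eq_bigr => k _; rewrite /lam_move.
  have [->|ne] := eqVneq k al; last by case: (k == be) => /=; rewrite ?addn0 ?addn1.
  rewrite addn1 prednK // (_ : (al == be) = false) ?addn0 //.
  by apply/negbTE; rewrite -val_eqE /= ltn_eqF.
by rewrite /on /= ltnS; case: (ltnP al j); case: (ltnP be j); lia.
Qed.

Lemma positions_initial (I : {ffun 'I_M.+1 -> {set 'I_n}}) s j : (j <= M.+1)%N ->
  (forall l m, (l \in I m) = (s l == m)) -> initial_seq I j = positions (conf s) j.
Proof.
move=> jM Is; rewrite /initial_seq /positions size_conf -val_enum_ord filter_map.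
congr map; rewrite {1}/enum_mem -enumT; apply: eq_filter => l /=.
rewrite nth_conf /on /= ltnS jM andbT.
apply/bigcupP/idP => [[m mj]|slj]; first by rewrite Is => /eqP ->.
by exists (s l); rewrite ?Is.
Qed.

Lemma Ufun_conf (lam : 'I_M.+1 -> nat) (I : {ffun 'I_M.+1 -> {set 'I_n}}) s x :
    (forall l m, (l \in I m) = (s l == m)) ->
    (forall j, (0 < j <= M.+1)%N -> lamsum lam j = cnt (conf s) j) ->
  Ufun h lam I x = weight (conf s) x.
Proof.
move=> Is lamE; rewrite weight_levels; last first.
  by apply/allP => r /mapP[l _ ->] /=.
rewrite /Ufun; apply: eq_big_nat => j jM; rewrite lamE; last by lia.
apply: eq_big_nat => a _; rewrite lamE ?lamE //; last by lia.
by rewrite /ipos !(positions_initial _ Is) //; lia.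
Qed.

End ConfigurationsOfBasisVectors.

(** * A ghost travelling through a configuration *)

Section MovingGhosts.
Variables (R : realType) (M n : nat) (lam : 'I_M.+1 -> nat) (h : cplx R).
Local Notation C := (cplx R).
Local Notation L := (lamsum lam).
Local Notation weight := (weight M h).
Local Notation state := {ffun 'I_n -> 'I_M.+1}.
Implicit Types (x y : nat -> nat -> C) (s : state).

Definition ghosted (c : seq item) (g : item) k : seq item := take k c ++ g :: drop k c.

Definition symW s x : C := Defs.Sym lam (weight (conf s)) x.

(** Blocks are numbered from 0 and levels from 1, so that the ghost for a move from
    block [al] to block [be] occupies the levels [al + 1], ..., [be]; it stands
    behind the first [k] items. *)
Definition symG s (al be : 'I_M.+1) k x : C :=
  Defs.Sym lam (weight (ghosted (conf s) (al.+1, be.+1) k)) x.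

Lemma ghosted_before s (al be : 'I_M.+1) (l : 'I_n) :
  ghosted (conf s) (al.+1, be.+1) l =
  take l (conf s) ++ (al.+1, be.+1) :: ((s l).+1, M.+2) :: drop l.+1 (conf s).
Proof.
rewrite /ghosted (drop_nth (0, 0)%N) ?size_conf // nth_conf.
by [].
Qed.

Lemma ghosted_after s (al be : 'I_M.+1) (l : 'I_n) :
  ghosted (conf s) (al.+1, be.+1) l.+1 =
  take l (conf s) ++ ((s l).+1, M.+2) :: (al.+1, be.+1) :: drop l.+1 (conf s).
Proof.
rewrite /ghosted (take_nth (0, 0)%N) ?size_conf // nth_conf cat_rcons.
by [].
Qed.

Section OneMove.
Variables (s : state) (l : 'I_n) (be : 'I_M.+1) (x : nat -> nat -> C).
Local Notation al := (s l).
Hypotheses (al_be : (al < be)%N) (sw : has_weight lam s) (dx : distinct lam x).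
Local Notation s' := (set_at s l be).
Local Notation ghost := ((al.+1, be.+1) : item).

Let be_M : (be <= M)%N. Proof. by rewrite -ltnS. Qed.

Lemma cnt_moved j : (j <= M.+1)%N -> (cnt (conf s') j + on ghost j)%N = L j.
Proof.
move=> jM; rewrite -(cnt_conf sw jM) conf_set_at [in RHS](conf_split s l).
rewrite !cnt_cat /= -addnA; congr (_ + _)%N; rewrite addnAC; congr (_ + _)%N.
by rewrite /on /= !ltnS jM; case: (leqP j al); case: (leqP j be); lia.
Qed.

Lemma cnt_ghosted k j : (j <= M.+1)%N -> cnt (ghosted (conf s') ghost k) j = L j.
Proof.
move=> jM; rewrite -cnt_moved // /ghosted -[in RHS](cat_take_drop k (conf s')).
by rewrite !cnt_cat /= addnAC addnA.
Qed.

Lemma ghost_step (k : 'I_n) : symG s' al be k.+1 x - symG s' al be k x =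
  if s' k == be then h * symW (set_at s' k al) x else 0.
Proof.
rewrite /symG /symW [conf (set_at _ k _)]conf_set_at ghosted_before ghosted_after.
have sk : (s' k <= M)%N by rewrite -ltnS.
rewrite (crossing h (e := be)) //; last first.
  by move=> j /andP[_ jM]; rewrite -ghosted_after cnt_ghosted // leqW.
Qed.

(** By [crossing], only the elements of block [be] which the ghost passes contribute,
    each by the weight with this element moved to the block [s l]. *)
Lemma ghost_telescope k k' : (k <= k' <= n)%N ->
  symG s' al be k' x - symG s' al be k x =
  h * \sum_(p < n | (k <= p < k')%N && (s' p == be)) symW (set_at s' p al) x.
Proof.
move=> /andP[kk' k'n]; rewrite -(telescope_sumr (fun i => symG s' al be i x) kk').
rewrite (big_nat_widenl k 0) // (big_nat_widen 0 k' n) // big_mkord mulr_sumr.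
rewrite [LHS]big_mkcond [RHS]big_mkcond; apply: eq_bigr => p _ /=.
by rewrite ghost_step; case: (k <= p < k')%N.
Qed.

Lemma take_drop_moved :
  take l (conf s') = take l (conf s) /\ drop l.+1 (conf s') = drop l.+1 (conf s).
Proof.
have le_l : (l <= size (conf s))%N by rewrite size_conf ltnW.
rewrite conf_set_at take_size_cat ?size_takel //; split=> //.
by rewrite drop_cat size_takel // ltnNge leqnSn /= subSnn /= drop0.
Qed.

(** Next to the element [l] from which it was taken, the ghost restores the item of
    [l] in the original configuration. *)
Lemma ghost_after : symG s' al be l.+1 x =
  Defs.Sym lam (fun y => (y be (cnt (take l (conf s)) be)
    - y be.+1 (cnt (take l (conf s)) be.+1)) * weight (conf s) y) x.
Proof.
rewrite /symG ghosted_after {2}/set_at ffunE eqxx.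
have [tE dE] := take_drop_moved.
apply: Sym_ext => y; rewrite tE dE weight_full_ghost_touch //.
by rewrite -conf_split.
Qed.

Lemma ghost_before : symG s' al be l x =
  Defs.Sym lam (fun y => (y be (cnt (take l (conf s)) be)
    - y be.+1 (cnt (take l (conf s)) be.+1) - h) * weight (conf s) y) x.
Proof.
rewrite /symG ghosted_before {2}/set_at ffunE eqxx.
have [tE dE] := take_drop_moved.
apply: Sym_ext => y; rewrite tE dE weight_ghost_full_touch //.
by rewrite -conf_split.
Qed.

(** The two parts of the discrete differential are the ghost at the front and the
    ghost at the end; the rotation of the variables needed for the former is
    absorbed by the symmetrization. *)
Lemma ddiff_ghost (q : 'rV[C]_M.+1) (J : {ffun 'I_M.+1 -> {set 'I_n}}) :
    (forall k m, (k \in J m) = (s' k == m)) ->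
  ddiff h lam q al be (Ufun h (lam_move lam al be) J) x =
  (q 0 be * symG s' al be 0 x - q 0 al * symG s' al be n x) / (q 0 al - q 0 be).
Proof.
move=> Js.
have UE y : Ufun h (lam_move lam al be) J y = weight (conf s') y.
  apply: Ufun_conf => // j /andP[_ jM]; apply: (@addIn (on ghost j)).
  by rewrite lamsum_move ?cnt_moved // (has_weight_gt0 sw (erefl (s l))).
have top : (0 < L be.+1)%N.
  rewrite /lamsum (bigD1 (s l)) /=; last by rewrite ltnS ltnW.
  by rewrite ltn_addr // (has_weight_gt0 sw (erefl (s l))).
have firstE : Defs.Sym lam (fun y => weight (conf s') y * Afun h lam al.+1 be.+1 y) x =
    symG s' al be 0 x.
  rewrite /symG /ghosted take0 drop0 /=.
  have ul : uniq (iota al.+1 (be - al)) by apply: iota_uniq.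
  rewrite -[RHS](Sym_rotate _ _ (l := iota al.+1 (be - al))); last first.
    by apply/allP => j; rewrite mem_iota; lia.
  apply: Sym_ext => y; rewrite (weight_ghost_first h al_be be_M cnt_moved top (y := y)) //.
  - move=> j r lt_r; rewrite /on /= ltnS.
    have [jin|jout] := boolP (al < j <= be)%N; last first.
      by rewrite rotate_level // mem_iota ifF ?add0n //; apply/negbTE; lia.
    rewrite add1n rotateS //; first by rewrite mem_iota; lia.
    by rewrite -cnt_moved ?/on /= ?ltnS ?jin ?addn1 //; lia.
  move=> j jin; rewrite rotate0 //; first by rewrite mem_iota; lia.
  by rewrite -cnt_moved ?/on /= ?ltnS ?jin ?addn1 //; lia.
have lastE : Defs.Sym lam (fun y => weight (conf s') y * Bfun h lam al.+1 be.+1 y) x =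
    symG s' al be n x.
  rewrite /symG /ghosted take_oversize ?size_conf // drop_oversize ?size_conf //.
  by apply: Sym_ext => y; rewrite (weight_ghost_last h al_be be_M cnt_moved top).
rewrite /ddiff -firstE -lastE -2!SymZ -SymB mulrC -SymZ.
by apply: Sym_ext => y; rewrite UE; ring.
Qed.

End OneMove.

Lemma sum_permute j j' (u : 'S_(L j')) y :
  \sum_(0 <= r < L j) permute j' u y j r = \sum_(0 <= r < L j) y j r.
Proof.
have [->|ne] := eqVneq j j'; last first.
  by apply: eq_bigr => r _; rewrite permuteE_out //; left.
rewrite !big_mkord [RHS](reindex_inj (@perm_inj _ u)); apply: eq_bigr => r _.
by rewrite (permuteE_in _ _ _ (ltn_ord r)); congr (y _ (nat_of_ord (u _))); apply/val_inj.
Qed.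


Lemma sum_level s j y : has_weight lam s -> (j <= M.+1)%N ->
  \sum_(l | (s l < j)%N) y j (cnt (take l (conf s)) j) = \sum_(0 <= r < L j) y j r.
Proof.
move=> sw jM; rewrite -(cnt_conf sw jM) -sum_positions size_conf big_mkord.
by apply: eq_bigl => l; rewrite nth_conf /on /= ltnS jM andbT.
Qed.

Lemma cnt_top s (l : 'I_n) : cnt (take l (conf s)) M.+1 = l.
Proof.
rewrite /cnt; suff : all (fun r => on r M.+1) (take l (conf s)).
  by rewrite all_count => /eqP ->; rewrite size_takel // size_conf ltnW.
by apply/allP => r /mem_take /mapP[k _ ->]; rewrite /on /= ltn_ord ltnSn.
Qed.

Lemma telescope_above (i : 'I_M.+1) (f : nat -> C) :
  \sum_(j < M.+1 | (i < j)%N) (f j - f j.+1) = f i.+1 - f M.+1.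
Proof.
rewrite -[RHS]opprB -telescope_sumr // -sumrN (big_nat_widenl i.+1 0) // big_mkord.
by apply: eq_bigr => j _; rewrite opprB.
Qed.

(** The ghosts standing next to the item from which they were taken contribute
    the differences of the integration variables of consecutive levels at this
    item. Summation over the blocks telescopes, and leaves the sums of all
    variables of the two levels around the block [i]. *)
Lemma ghosts_at_home s (i : 'I_M.+1) x : has_weight lam s ->
  \sum_(j < M.+1 | (i < j)%N) \sum_(l | s l == i) symG (set_at s l j) i j l.+1 x
  - \sum_(j < M.+1 | (j < i)%N) \sum_(l | s l == j) symG (set_at s l i) j i l x
  = (\sum_(0 <= r < L i.+1) x i.+1 r - \sum_(0 <= r < L i) x i r
     - \sum_(l | s l == i) x M.+1 l + h * \sum_(j < M.+1 | (j < i)%N) (lam j)%:R)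
    * symW s x.
Proof.
move=> sw.
pose v y j (l : 'I_n) := y j (cnt (take l (conf s)) j) : C.
pose phi y := \sum_(0 <= r < L i.+1) y i.+1 r - \sum_(0 <= r < L i) y i r
     - \sum_(l | s l == i) y M.+1 l + h * \sum_(j < M.+1 | (j < i)%N) (lam j)%:R : C.
rewrite -/(phi x) -Sym_pull; last first.
  move=> j u y jM; rewrite /phi !sum_permute; congr (_ - _ + _).
  by apply: eq_bigr => l _; rewrite permuteE_out //; left; lia.
transitivity (Defs.Sym lam (fun y =>
  \sum_(j < M.+1 | (i < j)%N) \sum_(l | s l == i) (v y j l - v y j.+1 l) * weight (conf s) y
  - \sum_(j < M.+1 | (j < i)%N) \sum_(l | s l == j)
      (v y i l - v y i.+1 l - h) * weight (conf s) y) x).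
  rewrite SymB !Sym_sum; congr (_ - _); apply: eq_bigr => j ij; rewrite Sym_sum;
    apply: eq_bigr => l /eqP sl.
  - by move: ij; rewrite -sl => ij; rewrite ghost_after.
  - by move: ij; rewrite -sl => ij; rewrite ghost_before.
apply: Sym_ext => y.
under eq_bigr do rewrite -mulr_suml.
under [X in _ - X]eq_bigr do rewrite -mulr_suml.
rewrite -!mulr_suml -mulrBl; congr (_ * _).
rewrite exchange_big /=.
under eq_bigr => l sl do rewrite (telescope_above i (fun j => v y j l)).
have -> : \sum_(j < M.+1 | (j < i)%N) \sum_(l | s l == j) (v y i l - v y i.+1 l - h) =
    \sum_(l | (s l < i)%N) (v y i l - v y i.+1 l - h).
  rewrite (partition_big s (fun j => j < i)%N) //=; apply: eq_bigr => j ji.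
  by apply: eq_bigl => l; case: eqP => [->|]; rewrite ?ji ?andbF.
have hE : \sum_(l | (s l < i)%N) h = h * \sum_(j < M.+1 | (j < i)%N) (lam j)%:R.
  rewrite sumr_const -mulr_natr -natr_sum; congr (_ * _%:R).
  by rewrite -[RHS](cnt_conf sw) ?cnt_conf_card // ltnW.
rewrite !sumrB hE /phi -!(sum_level _ sw) ?(ltnW (ltn_ord i)) //.
have -> : \sum_(l | (s l < i.+1)%N) v y i.+1 l =
    \sum_(l | s l == i) v y i.+1 l + \sum_(l | (s l < i)%N) v y i.+1 l.
  rewrite (bigID (fun l => s l == i)) /=; congr (_ + _); apply: eq_bigl => l.
    by case: eqP => [->|]; rewrite ?ltnSn ?andbF.
  by rewrite -val_eqE /=; lia.
have -> : \sum_(l | s l == i) v y M.+1 l = \sum_(l | s l == i) y M.+1 l.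
  by apply: eq_bigr => l _; rewrite /v cnt_top.
by rewrite -/(v y i); ring.
Qed.

End MovingGhosts.

(** * The dynamical operators in coordinates *)

Section TensorCoordinates.
Variables (R : realType) (M n : nat).
Local Notation C := (cplx R).
Local Notation state := {ffun 'I_n -> 'I_M.+1}.
Implicit Types (s : state) (w : tensor R M n).

Definition exchange_sites s (a b : 'I_n) : state := set_at (set_at s a (s b)) b (s a).

Lemma exchange_sitesC s a b : exchange_sites s a b = exchange_sites s b a.
Proof.
apply/ffunP => k; rewrite !ffunE.
by case: (k =P b) => [kb|_]; case: (k =P a) => [ka|_] //; rewrite -ka -kb.
Qed.

Lemma exchange_sites_id s a b : s a = s b -> exchange_sites s a b = s.
Proof. by move=> e; rewrite /exchange_sites [set_at s a _]set_at_id // set_at_id. Qed.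

Lemma tensorD w w' s : (w + w') s = w s + w' s. Proof. by rewrite ffunE. Qed.
Lemma tensorN w s : (- w) s = - w s. Proof. by rewrite ffunE. Qed.
Lemma tensorZ (k : C) w s : (k *: w) s = k * w s. Proof. by rewrite ffunE. Qed.
Lemma tensor_sum (I : Type) (r : seq I) (P : pred I) (f : I -> tensor R M n) s :
  (\sum_(k <- r | P k) f k) s = \sum_(k <- r | P k) f k s.
Proof. by rewrite sum_ffunE. Qed.

Lemma e_atE a i j w s : e_at a i j w s = if s a == i then w (set_at s a j) else 0.
Proof.
rewrite /e_at tensor_sum; under eq_bigr do rewrite tensorZ ffunE.
case: eqP => [sai|sai].
  rewrite (bigD1 (set_at s a j)) //= [X in _ * (X == j)%:R]ffunE !eqxx mulr1 set_at_twice.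
  rewrite (set_at_id sai) eqxx mulr1 big1 ?addr0 // => s' ne.
  case: (s =P _) => [es|_]; last by rewrite mulr0.
  case: (s' a =P j) => [s'a|_]; last by rewrite mulr0 mul0r.
  by move: ne; rewrite es set_at_twice set_at_id ?eqxx.
rewrite big1 // => s' _; case: (s =P _) => [es|_]; last by rewrite mulr0.
by case: sai; rewrite es ffunE eqxx.
Qed.

Lemma e_totE i j w s : e_tot i j w s = \sum_(a | s a == i) w (set_at s a j).
Proof.
by rewrite /e_tot tensor_sum [RHS]big_mkcond; apply: eq_bigr => a _; rewrite e_atE.
Qed.

Section AtWeight.
Variables (lam : 'I_M.+1 -> nat) (s : state) (i : 'I_M.+1).
Hypothesis sw : has_weight lam s.

Lemma sum_block (k : C) m : \sum_(a | s a == m) k = (lam m)%:R * k.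
Proof. by rewrite sumr_const sw mulr_natl. Qed.

Lemma e_tot_diag w : e_tot i i w s = (lam i)%:R * w s.
Proof.
by rewrite e_totE -sum_block; apply: eq_bigr => a /eqP sa; rewrite set_at_id.
Qed.

(** Sites in the same block carry the same basis vector, so that their pairs are
    merely counted: each site of block [i] is paired with itself, with the
    sites to its left and with those to its right. *)
Lemma count_block_pairs :
  2 * (\sum_(a | s a == i) \sum_(b < n | (a < b)%N && (s b == i)) (1 : C)) =
  (lam i)%:R * (lam i)%:R - (lam i)%:R.
Proof.
have -> : (lam i)%:R * (lam i)%:R = \sum_(a | s a == i) \sum_(b | s b == i) (1 : C).
  by under eq_bigr do rewrite sum_block mulr1; rewrite sum_block.
have split3 (a : 'I_n) : s a == i -> \sum_(b | s b == i) (1 : C) =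
    \sum_(b < n | (a < b)%N && (s b == i)) 1 + \sum_(b < n | (b < a)%N && (s b == i)) 1 + 1.
  move=> sa; rewrite (bigD1 a) //= addrC; congr (_ + _).
  rewrite (bigID (fun b : 'I_n => a < b)%N) /=; congr (_ + _); apply: eq_bigl => b;
    by rewrite -[b == a]val_eqE /=; case: (s b == i); rewrite ?andbF ?andbT //=; lia.
rewrite [in RHS](eq_bigr _ split3) !big_split /= sum_block mulr1 addrK.
rewrite (exchange_big_dep (fun b : 'I_n => s b == i)) /=; last by move=> a b _ /andP[].
rewrite mulr2n mulrDl mul1r; congr (_ + _); apply: eq_bigr => a sa.
by apply: eq_bigl => b; rewrite sa andbT andbC.
Qed.

Lemma e_at_exchange w (a b : 'I_n) : (a < b)%N ->
  \sum_(k < M.+1) e_at a i k (e_at b k i w) s =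
  if s a == i then w (exchange_sites s a b) else 0.
Proof.
move=> lt_ab; under eq_bigr do rewrite !e_atE.
case: eqP => sa; last by rewrite big1.
have ba : (b == a) = false by apply/negbTE; rewrite -val_eqE /= gtn_eqF.
rewrite (bigD1 (s b)) //= ffunE ba eqxx /exchange_sites sa big1 ?addr0 // => k ne.
by rewrite ffunE ba eq_sym (negPf ne).
Qed.

Lemma e_tot_exchange w j : j != i -> (e_tot i j (e_tot j i w) - e_tot i i w) s =
  \sum_(a | s a == i) \sum_(b | s b == j) w (exchange_sites s a b).
Proof.
have coordB (u v : tensor R M n) (A B : C) : u s = A -> v s = B -> (u - v) s = A - B.
  by move=> <- <-; rewrite tensorD tensorN.
move=> ne; apply: (etrans (coordB _ _ _ _ (e_totE i j _ s) (e_totE i i w s))).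
rewrite -sumrB.
apply: eq_bigr => a /eqP sa; rewrite (e_totE j i) (bigD1 a) /=; last by rewrite ffunE eqxx.
rewrite set_at_twice addrC addrK; apply: eq_big => b.
  by rewrite ffunE; case: (b =P a) => [->|]; rewrite ?andbF ?andbT // sa eq_sym (negPf ne).
by rewrite ffunE => /andP[/[swap] /negPf -> /eqP sb]; rewrite /exchange_sites sa sb.
Qed.

(** The quadratic term cancels the pairs of sites inside block [i], and the
    subtraction of the diagonal operator cancels the terms which return to the
    same site. Only transpositions of sites in different blocks remain. *)
Lemma XopE (h : C) (z : nat -> C) (q : 'rV[C]_M.+1) w :
  Xop h z q i w s = (\sum_(a | s a == i) z a) * w s
  - h * (\sum_(a | s a == i) \sum_(b < n | (a < b)%N && (s b != i)) w (exchange_sites s a b)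
     + \sum_(j < M.+1 | j != i) (q 0 j / (q 0 i - q 0 j)) *
         \sum_(a | s a == i) \sum_(b | s b == j) w (exchange_sites s a b)).
Proof.
rewrite /Xop.
set T3 := \sum_(a < n) _; set T2 := e_tot i i (w - _); set T1 := \sum_(a < n) _.
set T4 := \sum_(j < M.+1 | _) _.
rewrite (tensorD T1) tensorN tensorZ (tensorD (2^-1 *: T2 + T3)) (tensorD (2^-1 *: T2)).
rewrite (tensorZ _ T2) /T2 e_tot_diag (tensorD w) tensorN e_tot_diag.
rewrite /T1 /T3 /T4 !tensor_sum.
have -> : \sum_(a < n) (z a *: e_at a i i w) s = (\sum_(a | s a == i) z a) * w s.
  rewrite mulr_suml [RHS]big_mkcond; apply: eq_bigr => a _.
  by rewrite tensorZ e_atE; case: eqP => [sa|]; rewrite ?mulr0 // set_at_id.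
have -> : \sum_(a < n) (\sum_(b < n | (a < b)%N) \sum_(k < M.+1)
      e_at a i k (e_at b k i w)) s =
    \sum_(a | s a == i) \sum_(b < n | (a < b)%N && (s b != i)) w (exchange_sites s a b)
    + (\sum_(a | s a == i) \sum_(b < n | (a < b)%N && (s b == i)) 1) * w s.
  rewrite mulr_suml -big_split [RHS]big_mkcond; apply: eq_bigr => a _ /=.
  rewrite tensor_sum; under [LHS]eq_bigr => b ab do rewrite tensor_sum e_at_exchange //.
  case: eqP => sa; last by rewrite big1.
  rewrite (bigID (fun b => s b == i)) /= addrC; congr (_ + _).
  by rewrite mulr_suml; apply: eq_bigr => b /andP[_ /eqP sb];
    rewrite exchange_sites_id ?sb // mul1r.
have -> : \sum_(j < M.+1 | j != i) ((q 0 j / (q 0 i - q 0 j)) *: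
      (e_tot i j (e_tot j i w) - e_tot i i w)) s =
    \sum_(j < M.+1 | j != i) (q 0 j / (q 0 i - q 0 j)) *
         \sum_(a | s a == i) \sum_(b | s b == j) w (exchange_sites s a b).
  by apply: eq_bigr => j ne; rewrite tensorZ e_tot_exchange.
have two_n0 : (2 : C) != 0 by rewrite pnatr_eq0.
have := count_block_pairs; set P := \sum_(a | s a == i) \sum_(b | _ && (s b == i)) _.
move=> P2; have -> : P = 2^-1 * ((lam i)%:R * (lam i)%:R - (lam i)%:R).
  by rewrite -P2 mulKf.
by ring.
Qed.

(** The operator at [s] involves [w] only at [s] and its transpositions, so a factor
    common to these values comes out. *)
Lemma XopE_scaled (h : C) (z : nat -> C) (q : 'rV[C]_M.+1) w (w' : state -> C) (k : C) :
    w s = k * w' s ->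
    (forall a b, w (exchange_sites s a b) = k * w' (exchange_sites s a b)) ->
  Xop h z q i w s = k * ((\sum_(a | s a == i) z a) * w' s
  - h * (\sum_(a | s a == i) \sum_(b < n | (a < b)%N && (s b != i)) w' (exchange_sites s a b)
     + \sum_(j < M.+1 | j != i) (q 0 j / (q 0 i - q 0 j)) *
         \sum_(a | s a == i) \sum_(b | s b == j) w' (exchange_sites s a b))).
Proof.
move=> ws wX; rewrite XopE ws.
have pull (P : 'I_n -> pred 'I_n) :
    \sum_(a | s a == i) \sum_(b | P a b) w (exchange_sites s a b) =
    k * \sum_(a | s a == i) \sum_(b | P a b) w' (exchange_sites s a b).
  rewrite mulr_sumr; apply: eq_bigr => a _.
  by rewrite mulr_sumr; apply: eq_bigr => b _.
rewrite (pull (fun a b => (a < b)%N && (s b != i))).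
have -> : \sum_(j < M.+1 | j != i) (q 0 j / (q 0 i - q 0 j)) *
      \sum_(a | s a == i) \sum_(b | s b == j) w (exchange_sites s a b) =
    k * \sum_(j < M.+1 | j != i) (q 0 j / (q 0 i - q 0 j)) *
      \sum_(a | s a == i) \sum_(b | s b == j) w' (exchange_sites s a b).
  rewrite mulr_sumr; apply: eq_bigr => j _.
  by rewrite (pull (fun _ b => s b == j)) mulrCA.
by ring.
Qed.

End AtWeight.
End TensorCoordinates.

(** * The identity for one coordinate *)

Section CoefficientIdentity.
Variables (R : realType) (M n : nat) (lam : 'I_M.+1 -> nat) (h : cplx R).
Local Notation C := (cplx R).
Local Notation L := (lamsum lam).
Local Notation state := {ffun 'I_n -> 'I_M.+1}.
Local Notation W := (symW (M := M) lam h).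
Local Notation G := (symG (M := M) lam h).
Variables (q : 'rV[C]_M.+1) (x : nat -> nat -> C) (s : state).
Hypotheses (sw : has_weight lam s) (dx : distinct lam x).
Hypothesis q_distinct : forall i j, i != j -> q 0 i != q 0 j.

Local Notation Wx s := (W s x).
Local Notation exch l p := (Wx (exchange_sites s l p)).

Section OneGhost.
Variables (l : 'I_n) (be : 'I_M.+1).
Hypothesis al_be : (s l < be)%N.
Local Notation s' := (set_at s l be).

Lemma rejoin (p : 'I_n) : s p = be -> set_at s' p (s l) = exchange_sites s l p.
Proof. by move=> <-. Qed.

Lemma ghost_sum (P : pred 'I_n) : ~~ P l ->
  \sum_(p < n | P p && (s' p == be)) Wx (set_at s' p (s l)) =
  \sum_(p < n | P p && (s p == be)) exch l p.
Proof.
move=> nPl; apply: eq_big => p.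
  by rewrite ffunE; case: (p =P l) => [->|_] //; rewrite (negPf nPl).
rewrite ffunE; case: (p =P l) => [->|_] /andP[Pp]; first by rewrite Pp in nPl.
by move/eqP => sp; rewrite rejoin.
Qed.

Lemma ghost_end_sub_after :
  G s' (s l) be n x - G s' (s l) be l.+1 x =
  h * \sum_(p < n | (l < p)%N && (s p == be)) exch l p.
Proof.
rewrite (ghost_telescope h al_be sw dx) ?ltn_ord ?leqnn //; congr (_ * _).
rewrite -(ghost_sum (P := fun p => l < p)%N) ?ltnn //.
by apply: eq_bigl => p; rewrite ltn_ord andbT.
Qed.

Lemma ghost_before_sub_front :
  G s' (s l) be l x - G s' (s l) be 0 x =
  h * \sum_(p < n | (p < l)%N && (s p == be)) exch l p.
Proof.
rewrite (ghost_telescope h al_be sw dx); last exact: ltnW.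
congr (_ * _).
by rewrite -(ghost_sum (P := fun p => p < l)%N) ?ltnn.
Qed.

Lemma ghost_end_sub_front :
  G s' (s l) be n x - G s' (s l) be 0 x =
  h * (Wx s + \sum_(p < n | s p == be) exch l p).
Proof.
rewrite (ghost_telescope h al_be sw dx) //= ; congr (_ * _).
rewrite (bigD1 l) /=; last by rewrite ltn_ord ffunE !eqxx.
rewrite set_at_twice set_at_id //; congr (_ + _).
rewrite (eq_bigl (fun p => (p != l) && (s' p == be))) => [|p]; last first.
  by rewrite ltn_ord /= andbC.
rewrite (ghost_sum (P := fun p => p != l)) ?eqxx //; apply: eq_bigl => p.
case: (p =P l) => [->|] //=; apply/esym/negbTE.
by rewrite -val_eqE /= ltn_eqF.
Qed.

(** The ghost at one end is expressed through the ghost at the other end, which is then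
    brought home. The end is chosen such that the coefficient becomes
    [q_j / (q_i - q_j)], where [i] is the block of the derivative and [j] the
    other block: here [i] is the lower block, in [ddiff_down] the upper one. *)
Lemma ddiff_up : (q 0 be * G s' (s l) be 0 x - q 0 (s l) * G s' (s l) be n x)
    / (q 0 (s l) - q 0 be) =
  - (q 0 be / (q 0 (s l) - q 0 be) * (h * (Wx s + \sum_(p < n | s p == be) exch l p))
     + G s' (s l) be l.+1 x + h * \sum_(p < n | (l < p)%N && (s p == be)) exch l p).
Proof.
rewrite -ghost_end_sub_front -ghost_end_sub_after.
have d0 : q 0 (s l) - q 0 be != 0.
  by rewrite subr_eq0 q_distinct // -val_eqE /= ltn_eqF.
by field.
Qed.

Lemma ddiff_down : (q 0 be * G s' (s l) be 0 x - q 0 (s l) * G s' (s l) be n x)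
    / (q 0 (s l) - q 0 be) =
  q 0 (s l) / (q 0 be - q 0 (s l)) * (h * (Wx s + \sum_(p < n | s p == be) exch l p))
  - G s' (s l) be l x + h * \sum_(p < n | (p < l)%N && (s p == be)) exch l p.
Proof.
rewrite -ghost_end_sub_front -ghost_before_sub_front.
have ne : s l != be by rewrite -val_eqE /= ltn_eqF.
have d0 : q 0 (s l) - q 0 be != 0 by rewrite subr_eq0 q_distinct.
have d1 : q 0 be - q 0 (s l) != 0 by rewrite subr_eq0 q_distinct // eq_sym.
by field; rewrite d0 d1.
Qed.

End OneGhost.

Variable i : 'I_M.+1.

Lemma sum_neq (f : 'I_M.+1 -> C) : \sum_(j < M.+1 | j != i) f j =
  \sum_(j < M.+1 | (j < i)%N) f j + \sum_(j < M.+1 | (i < j)%N) f j.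
Proof.
rewrite (bigID (fun j : 'I_M.+1 => j < i)%N) /=; congr (_ + _); apply: eq_bigl => j.
  by rewrite -val_eqE /=; lia.
by rewrite -val_eqE /=; lia.
Qed.

(** A transposition of two sites in different blocks arises from exactly one ghost:
    the one taken from the site which is in the lower block. *)
Lemma split_exchanges :
  \sum_(a | s a == i) \sum_(b < n | (a < b)%N && (s b != i)) exch a b =
  \sum_(j < M.+1 | (j < i)%N) \sum_(l | s l == j)
     \sum_(p < n | (p < l)%N && (s p == i)) exch l p
  + \sum_(j < M.+1 | (i < j)%N) \sum_(l | s l == i)
     \sum_(p < n | (l < p)%N && (s p == j)) exch l p.
Proof.
transitivity (\sum_(j < M.+1 | j != i) \sum_(a | s a == i)
    \sum_(b < n | (a < b)%N && (s b == j)) exch a b).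
  rewrite exchange_big /=; apply: eq_bigr => a _.
  rewrite (partition_big s (fun j => j != i)) /= => [|b /andP[] //].
  apply: eq_bigr => j ne; apply: eq_bigl => b.
  by case: (s b =P j) => [->|]; rewrite ?andbF ?ne ?andbT.
rewrite sum_neq; congr (_ + _); apply: eq_bigr => j _.
rewrite (exchange_big_dep (fun b : 'I_n => s b == j)) /=; last by move=> a b _ /andP[].
apply: eq_bigr => b sb; apply: eq_big => a; first by rewrite sb andbT andbC.
by rewrite exchange_sitesC.
Qed.

(** This is [kap * q_i] times the logarithmic derivative in [q_i] of the master function
    with its prefactor. *)
Definition logder : C :=
  \sum_(0 <= r < L i.+1) x i.+1 r - \sum_(0 <= r < L i) x i r
  + h * (\sum_(j < M.+1 | (i < j)%N) (lam i)%:R * (q 0 j / (q 0 i - q 0 j))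
         + \sum_(j < M.+1 | (j < i)%N) (lam j)%:R * (q 0 i / (q 0 i - q 0 j))).

(** The contributions with a coefficient [q_j / (q_i - q_j)] come from ghosts travelling
    all the way, the transpositions without it from ghosts travelling from one
    end to their home, and the variables themselves from the ghosts at home. *)
Lemma coefficient_identity :
  logder * Wx s
  - ((\sum_(a | s a == i) x M.+1 a) * Wx s
     - h * (\sum_(a | s a == i) \sum_(b < n | (a < b)%N && (s b != i)) exch a b
        + \sum_(j < M.+1 | j != i) (q 0 j / (q 0 i - q 0 j)) *
            \sum_(a | s a == i) \sum_(b | s b == j) exch a b))
  = \sum_(j < M.+1 | (j < i)%N) \sum_(l | s l == j)
      (q 0 i * G (set_at s l i) j i 0 x - q 0 j * G (set_at s l i) j i n x)
        / (q 0 j - q 0 i)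
    - \sum_(j < M.+1 | (i < j)%N) \sum_(l | s l == i)
      (q 0 j * G (set_at s l j) i j 0 x - q 0 i * G (set_at s l j) i j n x)
        / (q 0 i - q 0 j).
Proof.
pose c j := q 0 j / (q 0 i - q 0 j).
pose E j := \sum_(a | s a == i) \sum_(b | s b == j) exch a b.
have downE : \sum_(j < M.+1 | (j < i)%N) \sum_(l | s l == j)
      (q 0 i * G (set_at s l i) j i 0 x - q 0 j * G (set_at s l i) j i n x)
        / (q 0 j - q 0 i) =
    h * \sum_(j < M.+1 | (j < i)%N) c j * ((lam j)%:R * Wx s + E j)
    - \sum_(j < M.+1 | (j < i)%N) \sum_(l | s l == j) G (set_at s l i) j i l x
    + h * \sum_(j < M.+1 | (j < i)%N) \sum_(l | s l == j)
            \sum_(p < n | (p < l)%N && (s p == i)) exch l p.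
  rewrite !mulr_sumr -sumrB -big_split; apply: eq_bigr => j ji /=.
  have -> : h * (c j * ((lam j)%:R * Wx s + E j)) = \sum_(l | s l == j)
      c j * (h * (Wx s + \sum_(p < n | s p == i) exch l p)).
    rewrite -!mulr_sumr big_split /= (sum_block sw) [E j]exchange_big /= mulrCA.
    by do 2 congr (_ * _); congr (_ + _); apply: eq_bigr => l _; apply: eq_bigr => p _;
      rewrite exchange_sitesC.
  rewrite mulr_sumr -sumrB -big_split; apply: eq_bigr => l /eqP sl /=.
  by rewrite -sl ddiff_down ?sl.
have upE : \sum_(j < M.+1 | (i < j)%N) \sum_(l | s l == i)
      (q 0 j * G (set_at s l j) i j 0 x - q 0 i * G (set_at s l j) i j n x)
        / (q 0 i - q 0 j) =
    - (h * \sum_(j < M.+1 | (i < j)%N) c j * ((lam i)%:R * Wx s + E j)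
    + \sum_(j < M.+1 | (i < j)%N) \sum_(l | s l == i) G (set_at s l j) i j l.+1 x
    + h * \sum_(j < M.+1 | (i < j)%N) \sum_(l | s l == i)
            \sum_(p < n | (l < p)%N && (s p == j)) exch l p).
  rewrite !mulr_sumr -!big_split -sumrN; apply: eq_bigr => j ji /=.
  have -> : h * (c j * ((lam i)%:R * Wx s + E j)) = \sum_(l | s l == i)
      c j * (h * (Wx s + \sum_(p < n | s p == j) exch l p)).
    by rewrite -!mulr_sumr big_split /= (sum_block sw) mulrCA.
  rewrite mulr_sumr -!big_split -sumrN; apply: eq_bigr => l /eqP sl /=.
  by rewrite /c -sl ddiff_up ?sl.
rewrite downE upE split_exchanges sum_neq.
have home := ghosts_at_home h i x sw.
set Ga := \sum_(j < M.+1 | (i < j)%N) \sum_(l | s l == i) G _ _ _ _ _ in home *.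
set Gb := \sum_(j < M.+1 | (j < i)%N) \sum_(l | s l == j) G _ _ _ _ _ in home *.
have -> : Ga = Gb + (\sum_(0 <= r < L i.+1) x i.+1 r - \sum_(0 <= r < L i) x i r
     - \sum_(l | s l == i) x M.+1 l + h * \sum_(j < M.+1 | (j < i)%N) (lam j)%:R)
    * Wx s by rewrite -home; ring.
have ratio : \sum_(j < M.+1 | (j < i)%N) (lam j)%:R * (q 0 i / (q 0 i - q 0 j)) =
    \sum_(j < M.+1 | (j < i)%N) (lam j)%:R
    + \sum_(j < M.+1 | (j < i)%N) c j * (lam j)%:R.
  rewrite -big_split; apply: eq_bigr => j ji /=.
  have d0 : q 0 i - q 0 j != 0.
    by rewrite subr_eq0 q_distinct // -val_eqE /= gtn_eqF.
  by rewrite /c; field.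
have distr (P : pred 'I_M.+1) (m : 'I_M.+1 -> C) :
    \sum_(j < M.+1 | P j) c j * (m j * Wx s + E j) =
    (\sum_(j < M.+1 | P j) c j * m j) * Wx s + \sum_(j < M.+1 | P j) c j * E j.
  by rewrite mulr_suml -big_split; apply: eq_bigr => j _ /=; ring.
rewrite !distr /logder ratio.
have -> : \sum_(j < M.+1 | (i < j)%N) (lam i)%:R * (q 0 j / (q 0 i - q 0 j)) =
    \sum_(j < M.+1 | (i < j)%N) c j * (lam i)%:R.
  by apply: eq_bigr => j _; rewrite mulrC.
by ring.
Qed.

End CoefficientIdentity.

(** * The complex exponential *)

Section ComplexExponential.
Variable R : realType.
Local Notation C := (cplx R).

Lemma cexpD (x y : C) : cexp (x + y) = cexp x * cexp y.
Proof.
case: x => a b; case: y => c d; rewrite /cexp /= expRD cosD sinD.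
by apply/eqP; rewrite eq_complex /=; apply/andP; split; apply/eqP; ring.
Qed.

Lemma cexp0 : cexp 0 = 1 :> C.
Proof. by rewrite /cexp /= expR0 cos0 sin0 mulr1 mulr0. Qed.

Lemma cexp_neq0 (x : C) : cexp x != 0.
Proof.
apply/eqP => e; have := cexpD x (- x).
by rewrite e mul0r subrr cexp0 => /eqP; rewrite oner_eq0.
Qed.

Lemma cnormE (z : C) : `|z| = (Num.sqrt (complex.Re z ^+ 2 + complex.Im z ^+ 2))%:C%C.
Proof. exact: normc_def. Qed.

Lemma cnorm_ge_Re (z : C) : (`|complex.Re z|%:C%C <= `|z| :> C).
Proof. exact: normc_ge_Re. Qed.

Lemma cnorm_ge_Im (z : C) : (`|complex.Im z|%:C%C <= `|z| :> C).
Proof.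
by rewrite cnormE lecR -sqrtr_sqr ler_wsqrtr // lerDr sqr_ge0.
Qed.

Lemma cnorm_le (z : C) : `|z| <= (`|complex.Re z| + `|complex.Im z|)%:C%C :> C.
Proof.
set r := _ + _; have r0 : 0 <= r by rewrite addr_ge0.
rewrite cnormE lecR -(ger0_norm r0) -(sqrtr_sqr r) ler_wsqrtr //.
by rewrite /r sqrrD !real_normK ?num_real // lerD2r lerDl mulrn_wge0.
Qed.

Lemma derive_small (f : R -> R) (c d e : R) : f 0 = c -> is_derive (0 : R) 1 f d -> 0 < e ->
  (\forall a \near (0 : R), `|f a - c - d * a| <= e * `|a|)%classic.
Proof.
move=> <- [df <-] e0.
have dfl : ((fun u => u^-1 *: ((f \o shift 0) (u *: 1) - f 0)) @ (0 : R)^' --> 'D_1 f 0)%classic.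
  exact: df.
have := cvgr_dist_le _ _ dfl _ e0; rewrite near_withinE => near0; near=> a.
have ha : a != 0 -> `|'D_1 f 0 - a^-1 *: ((f \o shift 0) (a *: 1) - f 0)| <= e.
  by near: a; exact: near0.
have [->|a0] := eqVneq a 0; first by rewrite mulr0 !subrr normr0 mulr0.
have := ha a0; rewrite /= addr0 [_%:A]mulr1 => {}ha.
rewrite -ler_pdivrMr ?normr_gt0 // -normfV -normrM -normrN.
suff -> : - ((f a - f 0 - 'D_1 f 0 * a) / a) = 'D_1 f 0 - a^-1 *: (f a - f 0) by [].
by rewrite /GRing.scale /=; field.
Unshelve. all: by end_near. Qed.


(** For [t = a + i b], the real and the imaginary part of the error are combinations of
    the first order errors of the real functions [expR], [cos], [sin], with bounded
    coefficients, and of [a * b]. *)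
Lemma cexp_small (e : R) : 0 < e -> exists2 d : R, 0 < d &
  forall t : C, `|t| < d%:C%C -> `|cexp t - 1 - t| <= e%:C%C * `|t|.
Proof.
(* The errors below add up to at most 7 times [eta] times the norm of [t]. *)
move=> e0; pose eta := Num.min 1 (e / 8); have eta0 : 0 < eta.
  by rewrite lt_min ltr01 divr_gt0.
have expS := derive_small (expR0 R) (is_derive_expR (0 : R)) eta0.
have cosS := derive_small (cos0 R) (is_derive_cos (0 : R)) eta0.
have sinS := derive_small (sin0 R) (is_derive_sin (0 : R)) eta0.
have etaS : (\forall a \near (0 : R), `|a| < eta)%classic.
  apply/nbhs_ballP; exists eta => // a; rewrite -ball_normE /ball_ /=.
  by rewrite sub0r normrN.
have /nbhs_ballP[d /= d0 dP] : (\forall a \near (0 : R),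
    [/\ `|expR a - 1 - expR 0 * a| <= eta * `|a|, `|cos a - 1 - - sin 0 * a| <= eta * `|a|,
        `|sin a - 0 - cos 0 * a| <= eta * `|a| & `|a| < eta])%classic.
  near=> a; split.
  - by near: a; exact: expS.
  - by near: a; exact: cosS.
  - by near: a; exact: sinS.
  - by near: a; exact: etaS.
exists d => // t td.
have [r tE] : exists r : R, `|t| = r%:C%C by eexists; exact: cnormE.
rewrite tE in td *.
have ler : forall u : R, `|u|%:C%C <= `|t| -> `|u| <= r by move=> u; rewrite tE lecR.
have ar := ler _ (cnorm_ge_Re t); have br := ler _ (cnorm_ge_Im t).
case: t tE td ar br {ler} => a b /= tE; rewrite ltcR => rd ar br.
have inball (u : R) : `|u| <= r -> ball (0 : R) d u.
  by move=> ur; rewrite -ball_normE /ball_ /= sub0r normrN (le_lt_trans ur).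
have [ea _ _ a_eta] := dP _ (inball _ ar).
have [_ cb sb b_eta] := dP _ (inball _ br).
rewrite expR0 mul1r in ea; rewrite sin0 oppr0 mul0r subr0 in cb.
rewrite cos0 mul1r subr0 in sb.
have r0 : 0 <= r by apply: le_trans ar.
have [eta1 eta8] : eta <= 1 /\ eta <= e / 8 by rewrite /eta !ge_min !lexx orbT.
apply: le_trans (cnorm_le _) _; rewrite -rmorphM lecR /=.
have le_ear (u v : R) : `|v| <= eta * `|u| -> `|u| <= r -> `|v| <= eta * r.
  by move=> vu ur; apply: le_trans vu _; rewrite ler_pM2l.
have Er := le_ear _ _ ea ar; have Cr := le_ear _ _ cb br; have Sr := le_ear _ _ sb br.
have a2 : `|1 + a| <= 2.
  by apply: le_trans (ler_normD _ _) _; rewrite normr1 lerD2l; apply: le_trans (ltW a_eta) _.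
have reE : `|expR a * cos b - 1 - a| <= 3 * (eta * r).
  have -> : expR a * cos b - 1 - a = (expR a - 1 - a) * cos b + (1 + a) * (cos b - 1) by ring.
  apply: le_trans (ler_normD _ _) _; rewrite !normrM.
  have -> : 3 * (eta * r) = (eta * r) * 1 + 2 * (eta * r) by ring.
  by apply: lerD; apply: ler_pM => //; exact: cos_max.
have imE : `|expR a * sin b - 0 - b| <= 4 * (eta * r).
  have -> : expR a * sin b - 0 - b =
      (expR a - 1 - a) * sin b + (1 + a) * (sin b - b) + a * b by ring.
  apply: le_trans (ler_normD _ _) _; have -> : 4 * (eta * r) = 3 * (eta * r) + eta * r by ring.
  apply: lerD; last by rewrite normrM; apply: ler_pM => //; exact: ltW.
  apply: le_trans (ler_normD _ _) _; rewrite !normrM.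
  have -> : 3 * (eta * r) = (eta * r) * 1 + 2 * (eta * r) by ring.
  by apply: lerD; apply: ler_pM => //; exact: sin_max.
apply: le_trans (lerD reE imE) _.
have : eta * r <= e / 8 * r by rewrite ler_wpM2r.
have : 0 <= eta * r by rewrite mulr_ge0 // ltW.
by lra.
Unshelve. all: by end_near. Qed.

Lemma is_derive_cexp (x : C) : is_derive x 1 (@cexp R) (cexp x).
Proof.
have lim1 : ((fun t : C => t^-1 *: (cexp t - 1)) @ (0 : C)^' --> (1 : C))%classic.
  apply/cvgrPdist_le => eps eps0.
  have epsE : eps = (complex.Re eps)%:C%C by exact: (esym (RRe_real (gtr0_real eps0))).
  have e0 : 0 < complex.Re eps by move: eps0; rewrite epsE ltcR.
  have [d d0 dP] := cexp_small e0; rewrite -epsE in dP.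
  have d0' : 0 < (d%:C%C : C) by rewrite ltcR.
  near=> t; have t0 : t != 0 by near: t; exact: nbhs_dnbhs_neq.
  have td : `|t| < d%:C%C by near: t; exact: dnbhs0_lt.
  have -> : 1 - t^-1 *: (cexp t - 1) = - ((cexp t - 1 - t) / t).
    by rewrite /GRing.scale /=; field.
  by rewrite normrN normrM normfV ler_pdivrMr ?normr_gt0 // dP.
have limx : ((fun t : C => t^-1 *: ((@cexp R \o shift x) (t *: (1 : C)) - cexp x)) @ (0 : C)^'
    --> (cexp x * 1 : C))%classic.
  have -> : (fun t : C => t^-1 *: ((@cexp R \o shift x) (t *: (1 : C)) - cexp x)) =
      (fun t : C => cexp x * (t^-1 *: (cexp t - 1))).
    apply/funext => t; rewrite /= cexpD /GRing.scale /= mulr1.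
    by ring.
  exact: cvgMl_tmp lim1.
suff dx : is_derive x 1 (@cexp R) (cexp x * 1) by apply: (is_derive_eq dx); rewrite mulr1.
split; first by apply/cvg_ex; exists (cexp x * 1).
exact: cvg_lim.
Unshelve. all: by end_near. Qed.

End ComplexExponential.

(** * Logarithmic derivatives of branches *)

Section LogarithmicDerivatives.
Variables (R : realType) (M : nat).
Local Notation C := (cplx R).
Local Notation V := 'rV[C]_M.+1.
Implicit Types (q v : V) (f g L : V -> C).

Lemma is_derive_cexp_comp g q v : differentiable g q ->
  is_derive q v (fun p => cexp (g p)) (cexp (g q) * 'D_v g q).
Proof.
move=> dg; have [dc cE] := is_derive_cexp (g q).
have dcexp : differentiable (@cexp R) (g q) by apply/derivable1_diffP.
have dcomp := differentiable_comp dg dcexp.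
change (is_derive q v (@cexp R \o g) (cexp (g q) * 'D_v g q)).
split; first exact: diff_derivable.
rewrite (deriveE v dcomp) (diff_comp dg dcexp) (deriveE v dg).
rewrite [LHS]/= (diff1E dcexp).
rewrite derive1E cE.
by rewrite mulrC.
Qed.

(** Differentiating [cexp (L p) = f p] determines the derivative of the branch. *)
Lemma log_branch_derive f L q v df : log_branch f L q -> is_derive q v f df ->
  [/\ differentiable L q, f q != 0 & 'D_v L q = df / f q].
Proof.
move=> br [_ fE]; have [dL eL] := nbhs_singleton br.
have f0 : f q != 0 by rewrite -eL cexp_neq0.
split=> //; have [_ cE] := is_derive_cexp_comp v dL.
have near_f : (\forall p \near q, cexp (L p) = f p)%classic.
  by apply: filterS br => p [].
rewrite -fE -(near_eq_derive _ near_f) cE eL.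
by rewrite mulrC mulKf.
Qed.

(** Written without a quotient, so that zeros of [f] need no separate treatment. *)
Definition has_logder q v f (a : C) := is_derive q v f (f q * a).

Lemma logder_ext q v f g a : f =1 g -> has_logder q v f a -> has_logder q v g a.
Proof. by move=> /funext ->. Qed.

Lemma logder_cst q v (c : C) : has_logder q v (fun=> c) 0.
Proof. by rewrite /has_logder mulr0; exact: is_derive_cst. Qed.

Lemma logderM q v f g a b : has_logder q v f a -> has_logder q v g b ->
  has_logder q v (fun p => f p * g p) (a + b).
Proof.
move=> df dg; apply: (is_derive_eq (is_deriveM df dg)).
by rewrite /GRing.scale /=; ring.
Qed.

Lemma logder_prod (I : Type) (r : seq I) (P : pred I) (F : I -> V -> C) (a : I -> C) q v :
  (forall k, P k -> has_logder q v (F k) (a k)) ->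
  has_logder q v (fun p => \prod_(k <- r | P k) F k p) (\sum_(k <- r | P k) a k).
Proof.
move=> dF; elim: r => [|k r IH].
  by rewrite big_nil; apply: (logder_ext (f := fun=> 1) _ (logder_cst _ _ _)) => p; rewrite big_nil.
rewrite big_cons; case: ifP => Pk; last first.
  by apply: logder_ext IH => p; rewrite big_cons Pk.
apply: (logder_ext (f := fun p => F k p * \prod_(k <- r | P k) F k p)) => [p|].
  by rewrite big_cons Pk.
by apply: logderM => //; exact: dF.
Qed.

Lemma logder_branch f L q v df (c : C) : log_branch f L q -> is_derive q v f df ->
  has_logder q v (fun p => cexp (c * L p)) (c * (df / f q)).
Proof.
move=> br dfE; have [dL _ DL] := log_branch_derive br dfE.
have dcL : differentiable (fun p => c * L p) q by exact: (differentiableZ c dL).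
rewrite /has_logder -DL; apply: (is_derive_eq (is_derive_cexp_comp v dcL)).
have dLv : derivable L q v by exact: diff_derivable.
by congr (_ * _); exact: (deriveZ c dLv).
Qed.

Lemma is_derive_coord q (i j : 'I_M.+1) :
  is_derive q (delta_mx 0 i) (fun p : V => p 0 j) (j == i)%:R.
Proof.
have lim_coord : ((fun t : C => t^-1 *:
    (((fun p : V => p 0 j) \o shift q) (t *: (delta_mx 0 i : V)) - q 0 j)) @ (0 : C)^'
    --> ((j == i)%:R : C))%classic.
  apply: cvg_near_cst; near=> t.
  have t0 : t != 0 by near: t; exact: nbhs_dnbhs_neq.
  rewrite /= !mxE eqxx /= addrK /GRing.scale /=.
  by rewrite mulrA mulVf ?mul1r.
split; first by apply/cvg_ex; exists ((j == i)%:R).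
exact: cvg_lim.
Unshelve. all: by end_near. Qed.

Lemma is_derive_ratio q (i j k : 'I_M.+1) : q 0 k != 0 ->
  is_derive q (delta_mx 0 i) (fun p : V => p 0 j / p 0 k)
    ((j == i)%:R / q 0 k - q 0 j * (k == i)%:R / q 0 k ^+ 2).
Proof.
move=> qk; have [dk kE] := is_derive_coord q i k; have [dj jE] := is_derive_coord q i j.
have dV := derivableV (f := fun p : V => p 0 k) qk dk.
split; first exact: (derivableM (f := fun p : V => p 0 j) dj dV).
rewrite [LHS](deriveM (f := fun p : V => p 0 j) dj dV) jE.
rewrite (deriveV (f := fun p : V => p 0 k) qk dk) kE /GRing.scale /=.
by field.
Qed.

End LogarithmicDerivatives.

(** * The logarithmic derivative of the master function *)

Section MasterFunctionDerivative.
Variables (R : realType) (M n : nat) (h kap : cplx R) (lam : 'I_M.+1 -> nat).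
Local Notation C := (cplx R).
Local Notation L := (lamsum lam).
Local Notation V := 'rV[C]_M.+1.
Hypotheses (kap_neq0 : kap != 0) (lam_sum : (\sum_i lam i)%N = n).
Variables (x : nat -> nat -> C) (q : V).
Hypotheses (q_neq0 : forall i, q 0 i != 0) (q_distinct : forall i j, i != j -> q 0 i != q 0 j).
Variables (l_last : V -> C) (l_mid : 'I_M -> V -> C) (l_Om : 'I_M.+1 -> 'I_M.+1 -> V -> C).
Hypotheses (l_lastP : log_branch (base_last n lam) l_last q)
  (l_midP : forall i, log_branch (base_mid lam i) (l_mid i) q)
  (l_OmP : forall i j : 'I_M.+1, (i < j)%N -> log_branch (base_Omega i j) (l_Om i j) q).
Variable i : 'I_M.+1.
Local Notation v := (delta_mx 0 i : V).

Lemma is_derive_scale (c : C) (f : V -> C) df :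
  is_derive q v f df -> is_derive q v (fun p => c * f p) (c * df).
Proof. by move=> d; apply: (is_derive_eq (is_deriveZ c d)). Qed.

Let T k : C := \sum_(0 <= r < L k) x k r.

Lemma lamsum_top : L M.+1 = n.
Proof. by rewrite -lam_sum /lamsum; apply: eq_bigl => k; rewrite ltn_ord. Qed.

Lemma lamsum0 : L 0 = 0%N.
Proof. by rewrite /lamsum big_pred0. Qed.

Let d_last : C := (ord_max == i)%:R / q 0 ord_max.
Let d_mid (k : 'I_M) : C :=
  (inord k == i)%:R / q 0 (inord k) - (inord k.+1 == i)%:R / q 0 (inord k.+1).
Let d_Om (k j : 'I_M.+1) : C :=
  (q 0 j * (k == i)%:R / q 0 k ^+ 2 - (j == i)%:R / q 0 k) / (1 - q 0 j / q 0 k).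

Lemma logder_last (c : C) : has_logder q v (fun p => cexp (c * l_last p)) (c * d_last).
Proof.
pose c0 : C := cexp (0 +i* (pi * (n%:R - (lam ord_max)%:R)))%C.
have d := is_derive_scale c0 (is_derive_coord q i ord_max).
have := logder_branch c l_lastP d; rewrite /base_last -/c0 -mulf_div divff ?cexp_neq0 //.
by rewrite mul1r.
Qed.

Lemma logder_mid (k : 'I_M) (c : C) :
  has_logder q v (fun p => cexp (c * l_mid k p)) (c * d_mid k).
Proof.
pose c0 : C := cexp (0 +i* (pi * ((lam (inord k.+1))%:R - (lam (inord k))%:R)))%C.
have d := is_derive_scale c0 (is_derive_ratio i (inord k) (q_neq0 (inord k.+1))).
have := logder_branch c (l_midP k) d; rewrite /base_mid -/c0 -mulf_div divff ?cexp_neq0 //.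
rewrite mul1r; congr has_logder; congr (_ * _); rewrite /d_mid.
have [q0 q1] := (q_neq0 (inord k), q_neq0 (inord k.+1)).
by field; rewrite q0 q1.
Qed.

Lemma logder_Om (k j : 'I_M.+1) (c : C) : (k < j)%N ->
  has_logder q v (fun p => cexp (c * l_Om k j p)) (c * d_Om k j).
Proof.
move=> kj; have d := is_deriveB (is_derive_cst (1 : C) q v) (is_derive_ratio i j (q_neq0 k)).
have := logder_branch c (l_OmP kj) d; rewrite /base_Omega.
by congr has_logder; congr (_ * _); rewrite /d_Om sub0r opprB.
Qed.

Let Lambda : C :=
  \sum_(k < M.+1) \sum_(j < M.+1 | (k < j)%N) h * (lam k)%:R / kap * d_Om k j
  + (((\sum_(a < n) x M.+1 a) / kap * d_last + \sum_(k < M) T k.+1 / kap * d_mid k) + 0).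

Lemma logder_OmPhi : has_logder q v
  (fun p => Omega h kap lam l_Om p * Phi n h kap lam l_last l_mid x p) Lambda.
Proof.
apply: logderM.
  apply: logder_prod => k _; apply: logder_prod => j kj.
  exact: logder_Om.
apply: logderM; last exact: logder_cst.
apply: logderM; first exact: logder_last.
by apply: logder_prod => k _; exact: logder_mid.
Qed.

Lemma sum_delta (N : nat) (f : nat -> C) m : (m < N)%N ->
  \sum_(0 <= k < N) f k * (k == m)%:R = f m.
Proof.
move=> lt_m; rewrite big_mkord (bigD1 (Ordinal lt_m)) //= eqxx mulr1 big1 ?addr0 // => k ne.
by rewrite -val_eqE /= in ne; rewrite (negPf ne) mulr0.
Qed.

Lemma Lambda_mid : q 0 i * ((\sum_(a < n) x M.+1 a) * d_last + \sum_(k < M) T k.+1 * d_mid k)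
  = T i.+1 - T i.
Proof.
have topE : \sum_(a < n) x M.+1 a = T M.+1 by rewrite /T lamsum_top big_mkord.
have T0 : T 0 = 0 by rewrite /T lamsum0 big_geq.
have qdelta (k : 'I_M.+1) : q 0 i * ((k == i)%:R / q 0 k) = (k == i)%:R.
  by case: eqP => [->|_]; rewrite ?mul0r ?mulr0 // mul1r divff.
rewrite topE mulrDr mulrCA qdelta mulr_sumr.
rewrite -(sum_delta (fun k => T k.+1) (ltn_ord i)) -(sum_delta T (ltn_ord i)).
rewrite big_nat_recr //= [X in _ = _ - X]big_nat_recl //= T0 mul0r add0r.
rewrite [RHS]addrAC [RHS]addrC; congr (_ + _).
rewrite !big_mkord -sumrB; apply: eq_bigr => k _.
rewrite mulrCA mulrBr !qdelta -mulrBr -!val_eqE /= !inordK //.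
  by rewrite ltnS ltn_ord.
by rewrite ltnS ltnW.
Qed.

Lemma Lambda_Om : kap * q 0 i *
    (\sum_(k < M.+1) \sum_(j < M.+1 | (k < j)%N) h * (lam k)%:R / kap * d_Om k j) =
  h * (\sum_(j < M.+1 | (i < j)%N) (lam i)%:R * (q 0 j / (q 0 i - q 0 j))
       + \sum_(j < M.+1 | (j < i)%N) (lam j)%:R * (q 0 i / (q 0 i - q 0 j))).
Proof.
pose up j := (lam i)%:R * (q 0 j / (q 0 i - q 0 j)).
pose down k := (lam k)%:R * (q 0 i / (q 0 i - q 0 k)).
transitivity (h * \sum_(k < M.+1) \sum_(j < M.+1 | (k < j)%N)
    ((if k == i then up j else 0) + (if j == i then down k else 0))).
  rewrite !mulr_sumr; apply: eq_bigr => k _; rewrite !mulr_sumr; apply: eq_bigr => j kj.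
  have kj' : k != j by rewrite -val_eqE /= ltn_eqF.
  have [q0 q1] := (q_neq0 k, q_neq0 j).
  have d0 : q 0 k - q 0 j != 0 by rewrite subr_eq0 q_distinct.
  have d1 : q 0 j - q 0 k != 0 by rewrite subr_eq0 q_distinct // eq_sym.
  have d2 : 1 - q 0 j / q 0 k != 0 by rewrite -(divff q0) -mulrBl mulf_neq0 ?invr_neq0.
  rewrite /d_Om /up /down; case: (k =P i) => [ki|_]; case: (j =P i) => [ji|_] /=.
  - by move: kj'; rewrite ki ji eqxx.
  - by rewrite -ki; field; rewrite ?kap_neq0 ?q0 ?d0 ?d2.
  - by rewrite -ji; field; rewrite ?kap_neq0 ?q0 ?d0 ?d1 ?d2.
  - by rewrite !(mulr0, mul0r, subr0, addr0).
congr (_ * _); under eq_bigr do rewrite big_split /=.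
rewrite big_split /=; congr (_ + _).
  rewrite (bigD1 i) //= eqxx [X in _ + X]big1 ?addr0 // => k /negPf ->.
  by rewrite big1.
rewrite [RHS]big_mkcond; apply: eq_bigr => k _.
rewrite -big_mkcondr /=; case: ifP => ki.
  by rewrite (big_pred1 i) // => j /=; case: eqP => [->|]; rewrite ?ki ?andbF.
by rewrite big_pred0 // => j; case: eqP => [->|]; rewrite ?ki ?andbF.
Qed.

Lemma LambdaE : kap * q 0 i * Lambda = logder lam h q x i.
Proof.
rewrite /Lambda addr0 mulrDr Lambda_Om /logder addrC; congr (_ + _).
rewrite -/(T i.+1) -/(T i) -Lambda_mid.
have -> : \sum_(k < M) T k.+1 / kap * d_mid k = (\sum_(k < M) T k.+1 * d_mid k) / kap.
  by rewrite mulr_suml; apply: eq_bigr => k _; rewrite mulrAC.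
by field.
Qed.

Lemma logder_master : has_logder q v
  (fun p => Omega h kap lam l_Om p * Phi n h kap lam l_last l_mid x p)
  (logder lam h q x i / (kap * q 0 i)).
Proof.
rewrite -LambdaE mulrC mulKf ?mulf_neq0 //.
exact: logder_OmPhi.
Qed.

End MasterFunctionDerivative.

(** * Coordinates indexed by ordered partitions *)

Section OrderedPartitions.
Variables (R : realType) (M n : nat) (lam : 'I_M.+1 -> nat).
Local Notation C := (cplx R).
Local Notation state := {ffun 'I_n -> 'I_M.+1}.
Local Notation opart := {ffun 'I_M.+1 -> {set 'I_n}}.
Implicit Types (s : state) (I : opart).

Definition blocks s : opart := [ffun m => [set a | s a == m]%SET].

Definition has_weightb s := [forall m, #|[pred l | s l == m]| == lam m].

Lemma has_weightP s : reflect (has_weight lam s) (has_weightb s).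
Proof.
by apply: (iffP forallP) => sw m; [exact/eqP/sw | rewrite sw].
Qed.

Lemma blocksE s a m : (a \in blocks s m) = (s a == m).
Proof. by rewrite ffunE inE. Qed.

Lemma has_weightb_exchange s a b : has_weightb (exchange_sites s a b) = has_weightb s.
Proof.
apply: eq_forallb => m; congr (_ == _); rewrite -!sum1_card [RHS](reindex_inj (@perm_inj _ (tperm a b))) /=.
apply: eq_bigl => l; rewrite !inE !ffunE.
by case: tpermP => [->|->|/eqP/negPf -> /eqP/negPf -> //]; rewrite eqxx //; case: (a =P b) => [->|].
Qed.

Lemma opart_blocks s : is_opart lam (blocks s) = has_weightb s.
Proof.
rewrite /is_opart; have -> : [forall j, #|blocks s j| == lam j] = has_weightb s.
  apply: eq_forallb => m; congr (_ == _); apply: eq_card => a.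
  by rewrite blocksE inE.
case: has_weightb => //=; apply/andP; split.
  apply/forallP => j; apply/forallP => k; apply/implyP => ne.
  rewrite disjoint_subset; apply/fintype.subsetP => a; rewrite !inE !blocksE => /eqP ->.
  by [].
apply/eqP/setP => a; rewrite inE; apply/bigcupP; exists (s a) => //.
by rewrite blocksE.
Qed.

(** An ordered partition is determined by the basis vector which it indexes, so that at
    most one summand has a nonzero coordinate at [s]. *)
Lemma opart_coord (F : opart -> C) s :
  (\sum_(I | is_opart lam I) F I *: vpart R I) s = if has_weightb s then F (blocks s) else 0.
Proof.
rewrite tensor_sum.
pose code I : state := [ffun a => odflt ord0 [pick m | a \in I m]].
have codeK I : is_opart lam I -> blocks (code I) = I.
  case/and3P => _ /forallP disj /eqP cov; apply/ffunP => m; apply/setP => a.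
  rewrite blocksE ffunE; case: pickP => [m' am'|none] /=.
    apply/eqP/idP => [<- //|am]; apply/eqP/contraT => ne.
    have /forallP/(_ m)/implyP/(_ ne) := disj m'.
    by rewrite disjoint_subset => /fintype.subsetP/(_ a am'); rewrite inE am.
  have : a \in [set: 'I_n]%SET by rewrite inE.
  by rewrite -cov => /bigcupP[m' _]; rewrite none.
have blocksK : code (blocks s) = s.
  apply/ffunP => a; rewrite ffunE; case: pickP => [m|/(_ (s a))] /=.
    by rewrite blocksE => /eqP.
  by rewrite blocksE eqxx.
have coordE I : (F I *: vpart R I) s = F I * (s == code I)%:R.
  by rewrite tensorZ /vpart /vbasis ffunE.
under eq_bigr do rewrite coordE.
have [sw|nsw] := boolP (has_weightb s).
  rewrite (bigD1 (blocks s)) ?opart_blocks //= blocksK eqxx mulr1 big1 ?addr0 // => I.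
  case/andP => oI ne; case: eqP => [sE|]; last by rewrite mulr0.
  by move: ne; rewrite sE codeK ?eqxx.
rewrite big1 // => I oI; case: eqP => [sE|]; last by rewrite mulr0.
by move: nsw; rewrite -opart_blocks sE codeK // oI.
Qed.

End OrderedPartitions.

(** * The dynamical equation *)

Section DiscreteDifferential.
Variables (R : realType) (M n : nat) (h : cplx R) (lam : 'I_M.+1 -> nat).
Local Notation C := (cplx R).
Local Notation state := {ffun 'I_n -> 'I_M.+1}.
Variables (q : 'rV[C]_M.+1) (x : nat -> nat -> C) (s : state).
Hypothesis sw : has_weight lam s.

Lemma move_blocks l (al be : 'I_M.+1) k m : al != be -> s l = al ->
  (k \in move (blocks s) l al be m) = (set_at s l be k == m).
Proof.
move=> ne sl; rewrite !ffunE.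
have [->|ma] := eqVneq m al.
  by rewrite !inE; case: (k =P l) => [->|] //=; rewrite eq_sym (negPf ne).
have [->|mb] := eqVneq m be.
  by rewrite !inE; case: (k =P l) => //= _; rewrite eqxx.
rewrite inE; case: (k =P l) => [->|] //.
by rewrite sl eq_sym (negPf ma) eq_sym (negPf mb).
Qed.

Lemma Dfun_blocks i : Dfun h lam q (blocks s) i x =
  \sum_(j < M.+1 | (j < i)%N) \sum_(l | s l == j)
      (q 0 i * symG lam h (set_at s l i) j i 0 x - q 0 j * symG lam h (set_at s l i) j i n x)
        / (q 0 j - q 0 i)
  - \sum_(j < M.+1 | (i < j)%N) \sum_(l | s l == i)
      (q 0 j * symG lam h (set_at s l j) i j 0 x - q 0 i * symG lam h (set_at s l j) i j n x)
        / (q 0 i - q 0 j).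
Proof.
rewrite /Dfun; congr (_ - _); apply: eq_bigr => j ij; apply: eq_big => l.
- by rewrite blocksE.
- rewrite blocksE => /eqP sl; rewrite -sl in ij *; rewrite (ddiff_ghost h x ij sw) //.
  by move=> k m; rewrite move_blocks // -val_eqE /= ltn_eqF.
- by rewrite blocksE.
rewrite blocksE => /eqP sl; rewrite -sl in ij *; rewrite (ddiff_ghost h x ij sw) //.
by move=> k m; rewrite move_blocks // -val_eqE /= ltn_eqF.
Qed.

Lemma Wfun_blocks : (\sum_i lam i)%N = n -> Wfun h lam (blocks s) x = symW lam h s x.
Proof.
move=> lam_sum; apply: Sym_ext => y; apply: Ufun_conf => [l m|j /andP[_ jM]].
  exact: blocksE.
by rewrite (cnt_conf sw).
Qed.

End DiscreteDifferential.

Theorem theorem7p2 (R : realType) (M n : nat) (n_gt0 : (0 < n)%N)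
  (h kap : cplx R) (h_neq0 : h != 0) (kap_neq0 : kap != 0)
  (lam : 'I_M.+1 -> nat) (lam_sum : (\sum_i lam i)%N = n)
  (t : nat -> nat -> cplx R) (z : nat -> cplx R)
  (t_distinct : forall j a b : nat, (1 <= j <= M)%N ->
     (a < lamsum lam j)%N -> (b < lamsum lam j)%N -> a <> b -> t j a <> t j b)
  (q : 'rV[cplx R]_M.+1)
  (q_neq0 : forall i, q 0 i != 0)
  (q_distinct : forall i j, i != j -> q 0 i != q 0 j)
  (l_last : 'rV[cplx R]_M.+1 -> cplx R)
  (l_mid : 'I_M -> 'rV[cplx R]_M.+1 -> cplx R)
  (l_Om : 'I_M.+1 -> 'I_M.+1 -> 'rV[cplx R]_M.+1 -> cplx R)
  (l_lastP : log_branch (base_last n lam) l_last q)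
  (l_midP : forall i, log_branch (base_mid lam i) (l_mid i) q)
  (l_OmP : forall i j : 'I_M.+1, (i < j)%N ->
     log_branch (base_Omega i j) (l_Om i j) q)
  (i : 'I_M.+1) :
  let x := vars M t z in
  let OmPhi p :=
    Omega h kap lam l_Om p * Phi n h kap lam l_last l_mid x p in
  let Psi p := OmPhi p *: Wlam n h lam x in
  (forall s, derivable (fun p => Psi p s) q (delta_mx 0 i)) /\
  (kap * q 0 i) *: partial i Psi q - Xop h z q i (Psi q)
  = OmPhi q *: \sum_(I | is_opart lam I) Dfun h lam q I i x *: vpart R I.
Proof.
move=> x OmPhi Psi.
have dx : distinct lam x.
  move=> j a b jM; rewrite /x /vars.
  have -> : (j == M.+1) = false by lia.
  exact: t_distinct jM.
have zE a : x M.+1 a = z a by rewrite /x /vars eqxx.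
have dOmPhi : is_derive q (delta_mx 0 i) OmPhi
    (OmPhi q * (logder lam h q x i / (kap * q 0 i))).
  exact: (logder_master h kap_neq0 lam_sum x q_neq0 q_distinct l_lastP l_midP l_OmP i).
have WlamE s : Wlam n h lam x s = if has_weightb lam s then symW lam h s x else 0.
  rewrite /Wlam (opart_coord lam (fun I => Wfun h lam I x)).
  by case: has_weightP => // sw; rewrite Wfun_blocks.
have PsiE p s : Psi p s = OmPhi p * Wlam n h lam x s by rewrite tensorZ.
have dPsi s : is_derive q (delta_mx 0 i) (fun p => Psi p s)
    (OmPhi q * (logder lam h q x i / (kap * q 0 i)) * Wlam n h lam x s).
  have -> : (fun p => Psi p s) = (fun p => Wlam n h lam x s * OmPhi p).
    by apply/funext => p; rewrite PsiE mulrC.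
  by rewrite mulrC; exact: (is_derive_scale _ dOmPhi).
split=> [s|]; first by have [] := dPsi s.
have kq : kap * q 0 i != 0 by rewrite mulf_neq0.
apply/ffunP => s.
rewrite (tensorD ((kap * q 0 i) *: partial i Psi q)) tensorN tensorZ [LHS]/=.
have -> : partial i Psi q s = OmPhi q * (logder lam h q x i / (kap * q 0 i)) * Wlam n h lam x s.
  by rewrite ffunE; have [_ ->] := dPsi s.
rewrite tensorZ (opart_coord lam (fun I => Dfun h lam q I i x)).
have PsiX a b : Psi q (exchange_sites s a b) =
    OmPhi q * (if has_weightb lam s then symW lam h (exchange_sites s a b) x else 0).
  by rewrite PsiE WlamE has_weightb_exchange.
have := PsiE q s; rewrite WlamE; case: has_weightP PsiX => sw PsiX PsiS.
  rewrite [X in _ - X = _](XopE_scaled (w' := fun s => symW lam h s x) i sw h z q PsiS PsiX) (Dfun_blocks h _ _ sw).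
  rewrite -(coefficient_identity h sw dx q_distinct i).
  have -> : \sum_(a | s a == i) x M.+1 a = \sum_(a | s a == i) z a
    by apply: eq_bigr => a _; exact: zE.
  by field; rewrite kap_neq0 q_neq0.
(* Away from the weight [lam] everything vanishes, because transpositions of
   sites preserve the weight of a basis vector. *)
pose lam' m := #|[pred l | s l == m]|; have sw' : has_weight lam' s by [].
rewrite [X in _ - X = _](@XopE_scaled _ _ _ _ _ i sw' h z q _ (fun=> 0) 0) ?PsiS ?mulr0 ?mul0r ?subr0 //.
by move=> a b; rewrite PsiX !mulr0.
Qed.
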